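(* Let $\mathbb{F}$ be a field of characteristic different from $2$, and let $n,m\ge 1$ be integers at least one of which is even. Let $\phi_{\mathbf{Sp}}'\colon\mathbf{PSp}_{2n}\times\mathbf{PSp}_{2m}\hookrightarrow\mathbf{HSpin}_{4nm}$ and $\phi_{2n,2m}'\colon\mathbf{PSO}_{2n}\times\mathbf{PSO}_{2m}\hookrightarrow\mathbf{HSpin}_{4nm}$ be the homomorphisms induced by the lifted Kronecker tensor product maps. Then their Rost multipliers are equal, and $$(\phi_{\mathbf{Sp}}')^\dagger(q_{\mathbf{HSpin}_{4nm}})=(a\,q_{\mathbf{PSp}_{2n}},\,b\,q_{\mathbf{PSp}_{2m}}),\qquad(\phi_{2n,2m}')^\dagger(q_{\mathbf{HSpin}_{4nm}})=(a\,q_{\mathbf{PSO}_{2n}},\,b\,q_{\mathbf{PSO}_{2m}}),$$ where $(a,b)$ is given by the following table (rows: $n$ mod $4$; columns: $m$ mod $4$; blank entries do not occur): $$\begin{array}{c|cccc}&m\equiv0&m\equiv1&m\equiv2&m\equiv3\\\hline n\equiv0&(m,n)&(m,\tfrac n4)&(m,\tfrac n2)&(m,\tfrac n4)\\ n\equiv1&(\tfrac m4,n)&&(\tfrac m2,n)&\\ n\equiv2&(\tfrac m2,n)&(m,\tfrac n2)&(\tfrac m2,\tfrac n2)&(m,\tfrac n2)\\ n\equiv3&(\tfrac m4,n)&&(\tfrac m2,n)&\end{array}$$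
   Context: Groups (all split over $\mathbb{F}$). $\Omega_r$ is the $r\times r$ antidiagonal matrix of ones, $\Psi_{2r}=\begin{bmatrix}0&\Omega_r\\-\Omega_r&0\end{bmatrix}$. $\mathbf{SO}_r=\{A: A\,\Omega_rA^T\Omega_r=I,\ \det A=1\}$; $\mathbf{Spin}_r\twoheadrightarrow\mathbf{SO}_r$ its spin double cover; $\mathbf{PSO}_{2r}=\mathbf{SO}_{2r}/\{\pm I\}$; $\mathbf{Sp}_{2r}=\{A: A(-\Psi_{2r}A^T\Psi_{2r})=I\}$; $\mathbf{PSp}_{2r}=\mathbf{Sp}_{2r}/\{\pm I\}$. For $N$ even, $\mathbf{HSpin}_{2N}=\mathbf{Spin}_{2N}/\{1,\xi_1\}$, $\xi_1=\prod_{k\text{ odd},\,k<N}h_{\alpha_k}(-1)$, where $\alpha_k=e_k-e_{k+1}$ and $h_\alpha(t)=\alpha^\vee(t)$ is the coroot cocharacter. Maps. $\rho_{\mathbf{Sp}}\colon\mathbf{Sp}_{2n}\times\mathbf{Sp}_{2m}\to\mathbf{SO}_{4nm}$, $(A,B)\mapsto P^{-1}(A\otimes B)P$, where $P$ is block diagonal with $n$ blocks $J=\mathrm{diag}(I_m,-\Omega_m)$ followed by $n$ blocks $K=\mathrm{diag}(\Omega_m,I_m)$. $\rho_{2n,2m}\colon\mathbf{SO}_{2n}\times\mathbf{SO}_{2m}\to\mathbf{SO}_{4nm}$, $(A,B)\mapsto A\otimes B$. $\phi_{\mathbf{Sp}}\colon\mathbf{Sp}_{2n}\times\mathbf{Sp}_{2m}\to\mathbf{Spin}_{4nm}$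 and $\phi_{2n,2m}\colon\mathbf{Spin}_{2n}\times\mathbf{Spin}_{2m}\to\mathbf{Spin}_{4nm}$ are the unique homomorphisms lifting $\rho_{\mathbf{Sp}}$, respectively the composition of $\mathbf{Spin}_{2n}\times\mathbf{Spin}_{2m}\twoheadrightarrow\mathbf{SO}_{2n}\times\mathbf{SO}_{2m}$ with $\rho_{2n,2m}$, along $\mathbf{Spin}_{4nm}\twoheadrightarrow\mathbf{SO}_{4nm}$. When $n$ or $m$ is even, the compositions of $\phi_{\mathbf{Sp}}$, $\phi_{2n,2m}$ with $\mathbf{Spin}_{4nm}\twoheadrightarrow\mathbf{HSpin}_{4nm}$ factor through $\mathbf{PSp}_{2n}\times\mathbf{PSp}_{2m}$, respectively $\mathbf{PSO}_{2n}\times\mathbf{PSO}_{2m}$, giving the injections $\phi_{\mathbf{Sp}}'$ and $\phi_{2n,2m}'$. Rost multipliers. For a split semisimple group $G$ with split maximal torus $T_G$, character lattice $T_G^*$ and Weyl group $W_G$, consider the group $S^2(T_G^* )^{W_G}$ of $W_G$-invariant elements of the second symmetric power; for simple $G$ it is infinite cyclic, generated by the normalized Killing form $q_G$, and for a product it contains the direct sum of the groups of the factors. A homomorphism $\varphi\colon G\to H$ (taking $T_G$ into $T_H$) induces $\varphi^*\colon T_H^*\to T_G^*$ and $\varphi^\dagger\colon S^2(T_H^* )^{W_H}\to S^2(T_G^* )^{W_G}$; writing the image of $q_H$ as an integral combination of the normalized Killing forms of the factors of $G$, the coefficients are the Rost multipliers of $\varphi$. Here the tori are those coming from the diagonal tori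 $\mathrm{diag}(s_1,\dots,s_r,s_r^{-1},\dots,s_1^{-1})$ of $\mathbf{SO}_{2r}$, $\mathbf{Sp}_{2r}$, with $e_i\mapsto s_i$, and all character lattices are viewed in $\bigoplus\mathbb{Q}e_i$. The normalized Killing forms are: $q_{\mathbf{PSp}_{2r}}=q_{\mathbf{PSO}_{2r}}=\kappa\sum_{i=1}^re_i^2$ with $\kappa=1,2,4$ for $r\equiv0\pmod4$, $r\equiv2\pmod4$, $r$ odd respectively; $q_{\mathbf{HSpin}_{4r}}=\lambda\sum_{i=1}^{2r}e_i^2$ with $\lambda=\tfrac12,1,2$ for $r\equiv0\pmod4$, $r\equiv2\pmod4$, $r$ odd respectively. (These formulas are taken as the definition of $q$ in low-rank cases where the group is not simple.) *)

(* Defs.v *)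
From HB Require Import structures.
From mathcomp Require Import all_boot all_order all_algebra.
From mathcomp Require Import mxtens zify ring.
From mathcomp Require Import boolp.
From mathcomp Require Import mpoly.
Set Implicit Arguments.
Unset Strict Implicit.
Unset Printing Implicit Defensive.

Import GRing.Theory.
Local Open Scope ring_scope.
Local Open Scope quotient_scope.

(* Affine algebraic groups over F in the classical language: K is an algebraically
   closed field containing F (via iota), and a smooth affine group G over F is given
   by the group G(K) together with the coordinate ring F[G], seen as a ring of
   K-valued functions on G(K).  In characteristic different from 2 all groups
   below are smooth. *)

Section AlgebraicGroups.
Variables (F : fieldType) (K : closedFieldType) (iota : {rmorphism F -> K}).

Record algGroup := AlgGroup {
  points :> groupType;
  regular : (points -> K) -> Prop }.

(* The F-subalgebra of K-valued functions on X generated by gens. *)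
Inductive subalg (X : Type) (gens : (X -> K) -> Prop) : (X -> K) -> Prop :=
| subalg_gen f of gens f : subalg gens f
| subalg_const c : subalg gens (fun=> iota c)
| subalg_add f g of subalg gens f & subalg gens g :
    subalg gens (fun x => f x + g x)
| subalg_mul f g of subalg gens f & subalg gens g :
    subalg gens (fun x => f x * g x).

Definition alg_hom (G H : algGroup) (phi : G -> H) : Prop :=
  {morph phi : x y / (x * y)%g} /\
  (forall f : H -> K, regular f -> regular (f \o phi)).

(* An algebraic group with a chosen split maximal torus T whose characters are
   viewed in Q e_1 + ... + Q e_rank.  As T may be a cover or a quotient of the
   torus (K^* )^rank of the coordinates s_i, the relation torus_coord t s between
   the two need not be functional in either direction; e_i stands for t |-> s_i. *)
Record splitGroup := SplitGroup {
  alg_of :> algGroup;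
  rank : nat;
  torus_coord : alg_of -> 'rV[K]_rank -> Prop }.

Definition in_torus (G : splitGroup) (t : G) : Prop :=
  exists s, torus_coord t s.

(* F-characters of the torus T of G, given by functions on G of which only the
   restriction to T matters; F[T] is the restriction of F[G] to T. *)
Definition torus_char (G : splitGroup) (chi : G -> K) : Prop :=
  [/\ exists2 f, regular f & forall t, in_torus t -> chi t = f t,
      chi 1%g = 1
    & forall t u, in_torus t -> in_torus u -> chi (t * u)%g = chi t * chi u].

(* The character chi of T is \sum_i v_i e_i in \bigoplus_i Q e_i: some multiple
   k v with k > 0 is integral and k chi is the character s |-> \prod_i s_i^(k v_i). *)
Definition has_weight (G : splitGroup) (chi : G -> K) (v : 'rV[rat]_(rank G)) :
    Prop :=
  torus_char chi /\
  exists (k : nat) (z : 'I_(rank G) -> int),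
    [/\ (0 < k)%N,
        forall i, k%:R * v 0 i = (z i)%:~R
      & forall t s, torus_coord t s -> chi t ^+ k = \prod_i s 0 i ^ z i].

(* v seen in the first symmetric power of \bigoplus_i Q e_i. *)
Definition linear_form (r : nat) (v : 'rV[rat]_r) : {mpoly rat[r]} :=
  \sum_(i < r) v 0 i *: 'X_i.

(* S2_map phi Q Q': the quadratic polynomial Q is in S^2(T_H^* ), and Q' is its
   image in S^2(T_G^* ) under S^2(phi^* ), where phi^* chi = chi \o phi. *)
Inductive S2_map (G H : splitGroup) (phi : G -> H) :
  {mpoly rat[rank H]} -> {mpoly rat[rank G]} -> Prop :=
| S2_map_zero : S2_map phi 0 0
| S2_map_add Q Q' (chi psi : H -> K) u v u' v' of
      S2_map phi Q Q'
    & has_weight chi u & has_weight psi v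
    & has_weight (chi \o phi) u' & has_weight (psi \o phi) v' :
    S2_map phi (Q + linear_form u * linear_form v)
               (Q' + linear_form u' * linear_form v').

(* Q lies in S^2(T^* )^W, where W = N(T)/T acts on T through conjugation. *)
Definition S2_invariant (G : splitGroup) (Q : {mpoly rat[rank G]}) : Prop :=
  forall w : G,
    (forall t, in_torus t <-> in_torus (t ^ w)%g) ->
    S2_map (fun t : G => (t ^ w)%g) Q Q.

(* phi^dagger Q = Q', with phi^dagger : S^2(T_H^* )^W_H -> S^2(T_G^* )^W_G. *)
Definition dagger (G H : splitGroup) (phi : G -> H)
    (Q : {mpoly rat[rank H]}) (Q' : {mpoly rat[rank G]}) : Prop :=
  [/\ S2_invariant Q, S2_invariant Q' & S2_map phi Q Q'].

Definition prod_regular (G H : algGroup) : (G * H -> K) -> Prop :=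
  subalg (fun f => (exists2 g, regular g & f = g \o fst) \/
                   (exists2 h, regular h & f = h \o snd)).

Definition prodSG (G H : splitGroup) : splitGroup :=
  @SplitGroup (@AlgGroup (G * H)%type (@prod_regular G H)) (rank G + rank H)
    (fun t s => torus_coord t.1 (lsubmx s) /\ torus_coord t.2 (rsubmx s)).

(* Q1 on the e_i of the first factor plus Q2 on those of the second factor. *)
Definition S2_pair (r1 r2 : nat)
    (Q1 : {mpoly rat[r1]}) (Q2 : {mpoly rat[r2]}) : {mpoly rat[r1 + r2]} :=
  (Q1 \mPo [tuple 'X_(lshift r2 i) | i < r1]) +
  (Q2 \mPo [tuple 'X_(rshift r1 i) | i < r2]).

Definition rost_multipliers (G1 G2 H : splitGroup) (phi : prodSG G1 G2 -> H)
    (q : {mpoly rat[rank H]}) (q1 : {mpoly rat[rank G1]})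
    (q2 : {mpoly rat[rank G2]}) (a b : int) : Prop :=
  dagger phi q (S2_pair (q1 *~ a) (q2 *~ b)).

Record central_inv (G : groupType) := CentralInv {
  cinv : G;
  _ : forall x : G, (x * cinv = cinv * x)%g;
  _ : (cinv * cinv = 1)%g }.

Section Quotient.
Variables (G : groupType) (zc : central_inv G).
Local Notation z := (cinv zc).

Lemma cinvC (x : G) : (x * z = z * x)%g. Proof. by case: zc. Qed.
Lemma cinvM : (z * z = 1 :> G)%g. Proof. by case: zc. Qed.
Lemma cinvKr (x : G) : (x * z * z = x)%g.
Proof. by rewrite -mulgA cinvM mulg1. Qed.

Definition cinv_eq : rel G := fun x y => (y == x) || (y == x * z)%g.

Fact cinv_eq_refl : reflexive cinv_eq.
Proof. by move=> x; rewrite /cinv_eq eqxx. Qed.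
Fact cinv_eq_sym : forall x y, cinv_eq x y = cinv_eq y x.
Proof.
move=> x y; apply/idP/idP => /orP[] /eqP->; rewrite /cinv_eq ?eqxx //.
  by rewrite cinvKr eqxx orbT.
by rewrite cinvKr eqxx orbT.
Qed.
Fact cinv_eq_trans : transitive cinv_eq.
Proof.
move=> y x t /orP[] /eqP-> /orP[] /eqP->; rewrite /cinv_eq ?eqxx ?orbT //.
by rewrite cinvKr eqxx.
Qed.

Canonical cinv_eq_equiv := EquivRel cinv_eq
  cinv_eq_refl cinv_eq_sym cinv_eq_trans.

Definition quot2 := {eq_quot cinv_eq}.
HB.instance Definition _ := Choice.on quot2.
HB.instance Definition _ := EqQuotient.on quot2.

Definition quot2_proj (x : G) : quot2 := \pi_quot2 x.

Lemma quot2_projE (x y : G) : quot2_proj x = quot2_proj y <-> cinv_eq x y.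
Proof. by split => [/eqmodP|h]; last apply/eqmodP. Qed.

Lemma quot2_repr (x : quot2) : quot2_proj (repr x) = x.
Proof. exact: reprK. Qed.

Definition quot2_mul (x y : quot2) : quot2 := quot2_proj (repr x * repr y)%g.
Definition quot2_inv (x : quot2) : quot2 := quot2_proj (repr x)^-1%g.

Lemma quot2_projM (x y : G) :
  quot2_proj (x * y)%g = quot2_mul (quot2_proj x) (quot2_proj y).
Proof.
have hx : cinv_eq x (repr (quot2_proj x)).
  by apply/quot2_projE; rewrite quot2_repr.
have hy : cinv_eq y (repr (quot2_proj y)).
  by apply/quot2_projE; rewrite quot2_repr.
apply/quot2_projE; case/orP: hx => /eqP->; case/orP: hy => /eqP->.
- by rewrite cinv_eq_refl.
- by rewrite /cinv_eq mulgA eqxx orbT.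
- by rewrite /cinv_eq -mulgA -cinvC mulgA eqxx orbT.
- by rewrite /cinv_eq -(mulgA x z) (mulgA z) -cinvC cinvKr eqxx.
Qed.

Lemma quot2_projV (x : G) : quot2_proj x^-1%g = quot2_inv (quot2_proj x).
Proof.
have zV : (z^-1 = z :> G)%g by rewrite -[LHS]mul1g -cinvM mulgK.
have hx : cinv_eq x (repr (quot2_proj x)).
  by apply/quot2_projE; rewrite quot2_repr.
apply/quot2_projE; case/orP: hx => /eqP->; first by rewrite cinv_eq_refl.
by rewrite /cinv_eq invgM zV cinvC eqxx orbT.
Qed.

Fact quot2_mulA : associative quot2_mul.
Proof.
move=> x y t; rewrite -(quot2_repr x) -(quot2_repr y) -(quot2_repr t).
by rewrite -!quot2_projM mulgA.
Qed.
Fact quot2_mul1 : left_id (quot2_proj 1%g) quot2_mul.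
Proof. by move=> x; rewrite -(quot2_repr x) -quot2_projM mul1g. Qed.
Fact quot2_mulr1 : right_id (quot2_proj 1%g) quot2_mul.
Proof. by move=> x; rewrite -(quot2_repr x) -quot2_projM mulg1. Qed.
Fact quot2_mulV : left_inverse (quot2_proj 1%g) quot2_inv quot2_mul.
Proof.
by move=> x; rewrite -(quot2_repr x) -quot2_projV -quot2_projM mulVg.
Qed.
Fact quot2_mulrV : right_inverse (quot2_proj 1%g) quot2_inv quot2_mul.
Proof.
by move=> x; rewrite -(quot2_repr x) -quot2_projV -quot2_projM mulgV.
Qed.
HB.instance Definition _ := isGroup.Build quot2
  quot2_mulA quot2_mul1 quot2_mulr1 quot2_mulV quot2_mulrV.
End Quotient.

(* F[G / {1, z}] = F[G]^{1, z}. *)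
Definition quotSG (G : splitGroup) (z : central_inv G) : splitGroup :=
  @SplitGroup (@AlgGroup (quot2 z) (fun f => regular (f \o @quot2_proj G z)))
    (rank G)
    (fun t s => exists2 g : G, t = quot2_proj z g & torus_coord g s).

Record mxGroup (d : nat) := MxGroup {
  mx_in :> pred 'M[K]_d;
  _ : mx_in 1%:M;
  _ : forall A B, mx_in A -> mx_in B -> mx_in (A *m B);
  _ : forall A, mx_in A -> A \in unitmx /\ mx_in (invmx A) }.

Section MatrixGroup.
Variables (d : nat) (S : mxGroup d).

Record mxelt := MxElt { mxval :> 'M[K]_d; mxvalP : S mxval }.
HB.instance Definition _ := [isSub for mxval].
HB.instance Definition _ := [Choice of mxelt by <:].

Fact mxelt_1P : S 1%:M. Proof. by case: S. Qed.
Fact mxelt_mulP (A B : mxelt) : S (val A *m val B).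
Proof. by case: A B => A hA [B hB] /=; case: S hA hB => p ? + ? /=; apply. Qed.
Fact mxelt_unit (A : mxelt) : val A \in unitmx.
Proof. by case: A => A hA /=; case: S hA => p ? ? h /= /h[]. Qed.
Fact mxelt_invP (A : mxelt) : S (invmx (val A)).
Proof. by case: A => A hA /=; case: S hA => p ? ? h /= /h[]. Qed.

Definition mxelt_one : mxelt := MxElt mxelt_1P.
Definition mxelt_mul (A B : mxelt) : mxelt := MxElt (mxelt_mulP A B).
Definition mxelt_inv (A : mxelt) : mxelt := MxElt (mxelt_invP A).

Fact mxelt_mulA : associative mxelt_mul.
Proof. by move=> A B C; apply: val_inj => /=; rewrite mulmxA. Qed.
Fact mxelt_mul1 : left_id mxelt_one mxelt_mul.
Proof. by move=> A; apply: val_inj => /=; rewrite mul1mx. Qed.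
Fact mxelt_mulr1 : right_id mxelt_one mxelt_mul.
Proof. by move=> A; apply: val_inj => /=; rewrite mulmx1. Qed.
Fact mxelt_mulV : left_inverse mxelt_one mxelt_inv mxelt_mul.
Proof. by move=> A; apply: val_inj => /=; rewrite mulVmx // mxelt_unit. Qed.
Fact mxelt_mulrV : right_inverse mxelt_one mxelt_inv mxelt_mul.
Proof. by move=> A; apply: val_inj => /=; rewrite mulmxV // mxelt_unit. Qed.
HB.instance Definition _ := isGroup.Build mxelt
  mxelt_mulA mxelt_mul1 mxelt_mulr1 mxelt_mulV mxelt_mulrV.

(* The determinant is 1 in all groups below, so that it need not be inverted. *)
Definition mxAlgGroup : algGroup :=
  @AlgGroup mxelt (subalg (fun f => exists i j, f = fun A : mxelt => val A i j)).
End MatrixGroup.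

Definition Omega (r : nat) : 'M[K]_r :=
  \matrix_(i, j) ((i + j)%N == r.-1)%:R.

Definition Psi (r : nat) : 'M[K]_(r + r) :=
  block_mx 0 (Omega r) (- Omega r) 0.

Definition SO_pred (r : nat) : pred 'M[K]_r := fun A =>
  (A *m Omega r *m A^T *m Omega r == 1%:M) && (\det A == 1).

Definition Sp_pred (r : nat) : pred 'M[K]_(r + r) := fun A =>
  A *m (- (Psi r *m A^T *m Psi r)) == 1%:M.

Lemma Omega_sqr r : Omega r *m Omega r = 1%:M.
Proof.
apply/matrixP => i j; rewrite !mxE (bigD1 (rev_ord i)) //= !mxE /=.
have -> : ((i + (r - i.+1))%N == r.-1) = true by apply/eqP; have := ltn_ord i; lia.
rewrite mul1r big1 ?addr0 => [|k hk].
  congr (nat_of_bool _)%:R; have hi := ltn_ord i; have hj := ltn_ord j.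
  by apply/eqP/eqP => [h|<-]; [apply: val_inj => /=; lia | lia].
rewrite !mxE; case: eqP => [h|_]; last by rewrite mul0r.
case/eqP: hk; apply: val_inj => /=; have := ltn_ord i; have := ltn_ord k; lia.
Qed.

Lemma Omega_tr r : (Omega r)^T = Omega r.
Proof. by apply/matrixP => i j; rewrite !mxE addnC. Qed.

Lemma Psi_sqr r : Psi r *m Psi r = - 1%:M.
Proof.
rewrite /Psi mulmx_block !mul0mx !mulmx0 !add0r !addr0 mulmxN mulNmx Omega_sqr.
by rewrite -[0 in LHS]oppr0 -opp_block_mx -scalar_mx_block.
Qed.

Section Isometry.
Variables (d : nat) (M : 'M[K]_d).
Hypothesis M_unit : M \in unitmx.

Lemma isometry_mul (A B : 'M[K]_d) :
  A *m M *m A^T = M -> B *m M *m B^T = M -> A *m B *m M *m (A *m B)^T = M.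
Proof.
by move=> hA hB; rewrite trmx_mul !mulmxA -(mulmxA A) -(mulmxA A) hB.
Qed.

Lemma isometry_unit (A : 'M[K]_d) : A *m M *m A^T = M -> A \in unitmx.
Proof.
move=> hA; have : A *m (M *m A^T *m invmx M) = 1%:M.
  by rewrite !mulmxA hA mulmxV.
by case/mulmx1_unit.
Qed.

Lemma isometry_inv (A : 'M[K]_d) :
  A *m M *m A^T = M -> invmx A *m M *m (invmx A)^T = M.
Proof.
move=> hA; have uA := isometry_unit hA.
rewrite -{1}hA !mulmxA mulVmx // mul1mx -mulmxA -trmx_mul mulVmx //.
by rewrite trmx1 mulmx1.
Qed.
End Isometry.

Lemma SO_predP r (A : 'M[K]_r) :
  reflect (A *m Omega r *m A^T = Omega r /\ \det A = 1) (SO_pred A).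
Proof.
apply: (iffP andP) => -[h /eqP h1]; split=> //; [|apply/eqP].
  by rewrite -[LHS]mulmx1 -(Omega_sqr r) mulmxA (eqP h) mul1mx.
by rewrite h Omega_sqr.
Qed.

Lemma Sp_predP r (A : 'M[K]_(r + r)) :
  reflect (A *m Psi r *m A^T = Psi r) (Sp_pred A).
Proof.
have E : A *m (- (Psi r *m A^T *m Psi r)) = - (A *m Psi r *m A^T *m Psi r).
  by rewrite mulmxN !mulmxA.
apply: (iffP eqP); rewrite E => h; last by rewrite h Psi_sqr opprK.
rewrite -[LHS]mulmx1 -[1%:M]opprK -Psi_sqr mulmxN mulmxA -mulNmx.
by rewrite h mul1mx.
Qed.

Lemma Omega_unit r : Omega r \in unitmx.
Proof. by case/mulmx1_unit: (Omega_sqr r). Qed.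

Lemma Psi_unit r : Psi r \in unitmx.
Proof.
have : Psi r *m (- Psi r) = 1%:M by rewrite mulmxN Psi_sqr opprK.
by case/mulmx1_unit.
Qed.

Fact SO_1 r : @SO_pred r 1%:M.
Proof. by apply/SO_predP; rewrite mul1mx trmx1 mulmx1 det1. Qed.
Fact SO_M r (A B : 'M[K]_r) : SO_pred A -> SO_pred B -> SO_pred (A *m B).
Proof.
move=> /SO_predP[hA dA] /SO_predP[hB dB]; apply/SO_predP; split.
  exact: isometry_mul.
by rewrite det_mulmx dA dB mulr1.
Qed.
Fact SO_V r (A : 'M[K]_r) : SO_pred A -> A \in unitmx /\ SO_pred (invmx A).
Proof.
move=> /SO_predP[hA dA]; split; first exact: (isometry_unit (Omega_unit r) hA).
apply/SO_predP; split; first exact: (isometry_inv (Omega_unit r) hA).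
by rewrite det_inv dA invr1.
Qed.

Fact Sp_1 r : @Sp_pred r 1%:M.
Proof. by apply/Sp_predP; rewrite mul1mx trmx1 mulmx1. Qed.
Fact Sp_M r (A B : 'M[K]_(r + r)) : Sp_pred A -> Sp_pred B -> Sp_pred (A *m B).
Proof. by move=> /Sp_predP hA /Sp_predP hB; apply/Sp_predP/isometry_mul. Qed.
Fact Sp_V r (A : 'M[K]_(r + r)) :
  Sp_pred A -> A \in unitmx /\ Sp_pred (invmx A).
Proof.
move=> /Sp_predP hA; split; first exact: (isometry_unit (Psi_unit r) hA).
exact/Sp_predP/(isometry_inv (Psi_unit r)).
Qed.

Definition diag_torus (r : nat) (s : 'rV[K]_r) : 'M[K]_(r + r) :=
  diag_mx (row_mx s (\row_i (s 0 (rev_ord i))^-1)).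

(* From here on groups are indexed by their rank r: SO r is SO_{2r}, etc. *)

Definition SO_mx (r : nat) : mxGroup (r + r) :=
  MxGroup (@SO_1 (r + r)) (@SO_M (r + r)) (@SO_V (r + r)).
Definition Sp_mx (r : nat) : mxGroup (r + r) :=
  MxGroup (@Sp_1 r) (@Sp_M r) (@Sp_V r).

Definition SO (r : nat) : splitGroup :=
  @SplitGroup (mxAlgGroup (SO_mx r)) r (fun A s => mxval A = diag_torus s).

Definition Sp (r : nat) : splitGroup :=
  @SplitGroup (mxAlgGroup (Sp_mx r)) r (fun A s => mxval A = diag_torus s).

Fact SO_N1 r : @SO_pred (r + r) (- 1%:M).
Proof.
apply/SO_predP; split.
  by rewrite linearN /= trmx1 mulNmx mulmxN mulNmx mul1mx mulmx1 opprK.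
by rewrite -scaleN1r detZ det1 mulr1 addnn -signr_odd odd_double.
Qed.
Fact Sp_N1 r : @Sp_pred r (- 1%:M).
Proof.
apply/Sp_predP.
by rewrite linearN /= trmx1 mulNmx mulmxN mulNmx mul1mx mulmx1 opprK.
Qed.

Definition SO_opp (r : nat) : SO r := @MxElt _ (SO_mx r) _ (SO_N1 r).
Definition Sp_opp (r : nat) : Sp r := @MxElt _ (Sp_mx r) _ (Sp_N1 r).

Fact SO_oppC r (A : SO r) : (A * SO_opp r = SO_opp r * A)%g.
Proof. by apply: val_inj => /=; rewrite mulNmx mulmxN mulmx1 mul1mx. Qed.
Fact SO_oppM r : (SO_opp r * SO_opp r = 1)%g.
Proof. by apply: val_inj => /=; rewrite mulNmx mulmxN mulmx1 opprK. Qed.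
Fact Sp_oppC r (A : Sp r) : (A * Sp_opp r = Sp_opp r * A)%g.
Proof. by apply: val_inj => /=; rewrite mulNmx mulmxN mulmx1 mul1mx. Qed.
Fact Sp_oppM r : (Sp_opp r * Sp_opp r = 1)%g.
Proof. by apply: val_inj => /=; rewrite mulNmx mulmxN mulmx1 opprK. Qed.

Definition PSO (r : nat) : splitGroup :=
  quotSG (CentralInv (@SO_oppC r) (SO_oppM r)).
Definition PSp (r : nat) : splitGroup :=
  quotSG (CentralInv (@Sp_oppC r) (Sp_oppM r)).
(* The dimension 2^N of the exterior algebra of K^N, in the form needed to build
   its endomorphisms by blocks. *)
Fixpoint spin_dim (N : nat) : nat :=
  if N is N'.+1 then (spin_dim N' + spin_dim N')%N else 1%N.

(* The Clifford algebra of the split quadratic form \sum_k x_k y_k on K^(2N) is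
   the algebra of endomorphisms of the exterior algebra of W = K^N (spinors):
   the vector (x, y) acts as (wedge by x) + (contraction by y).  The blocks come
   from Lambda (K e_1 + W') = Lambda W' + e_1 Lambda W'. *)
Fixpoint clifford_rec (N : nat) : 'cV[K]_N -> 'cV[K]_N -> 'M[K]_(spin_dim N) :=
  match N with
  | 0%N => fun _ _ => 0
  | N'.+1 => fun x y =>
      let c := clifford_rec (\col_k x (lift ord0 k) 0) (\col_k y (lift ord0 k) 0) in
      block_mx c (y ord0 0)%:M (x ord0 0)%:M (- c)
  end.

(* The quadratic form (1/2) v^T Omega v and the image of v in its Clifford algebra. *)
Definition qform (N : nat) (v : 'cV[K]_(N + N)) : K :=
  \sum_(k < N) v (lshift N k) 0 * v (rev_ord (lshift N k)) 0.

Definition clifford (N : nat) (v : 'cV[K]_(N + N)) : 'M[K]_(spin_dim N) :=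
  clifford_rec (\col_k v (lshift N k) 0) (\col_k v (rev_ord (lshift N k)) 0).

Definition cliff_prod (N : nat) (s : seq 'cV[K]_(N + N)) : 'M[K]_(spin_dim N) :=
  \big[mulmx/1%:M]_(v <- s) clifford v.

(* Spin_{2N}(K) consists of the products of an even number of vectors whose norms
   have product 1. *)
Definition Spin_pred (N : nat) : pred 'M[K]_(spin_dim N) := fun g =>
  `[< exists s : seq 'cV[K]_(N + N),
        [/\ ~~ odd (size s), \prod_(v <- s) qform v = 1 & g = cliff_prod s] >].

Lemma clifford_rec_sqr N (x y : 'cV[K]_N) :
  clifford_rec x y *m clifford_rec x y = (\sum_k x k 0 * y k 0)%:M.
Proof.
elim: N x y => [|N IH] x y /=; first by rewrite mul0mx big_ord0 raddf0.
rewrite mulmx_block !mulNmx !mulmxN opprK IH !mul_mx_scalar !mul_scalar_mx.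
rewrite !subrr !scale_scalar_mx big_ord_recl.
under eq_bigr => k _ do rewrite !mxE.
rewrite -!raddfD /= [in RHS]scalar_mx_block.
by rewrite addrC [y _ _ * _]mulrC.
Qed.

Lemma clifford_sqr N (v : 'cV[K]_(N + N)) :
  clifford v *m clifford v = (qform v)%:M.
Proof.
by rewrite clifford_rec_sqr; congr (_%:M); apply: eq_bigr => k _; rewrite !mxE.
Qed.

Lemma clifford_rec_lin N a (x y x' y' : 'cV[K]_N) :
  clifford_rec (a *: x + x') (a *: y + y') =
  a *: clifford_rec x y + clifford_rec x' y'.
Proof.
elim: N x y x' y' => [|N IH] x y x' y' /=; first by rewrite scaler0 addr0.
have E (z z' : 'cV[K]_N.+1) : \col_k (a *: z + z') (lift ord0 k) 0 =
    a *: (\col_k z (lift ord0 k) 0) + \col_k z' (lift ord0 k) 0.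
  by apply/matrixP => i j; rewrite !mxE.
rewrite !E IH !mxE scale_block_mx add_block_mx.
by rewrite !scale_scalar_mx -!raddfD /= scalerN opprD.
Qed.

Lemma clifford_lin N a (u v : 'cV[K]_(N + N)) :
  clifford (a *: u + v) = a *: clifford u + clifford v.
Proof.
rewrite -clifford_rec_lin; congr clifford_rec; apply/matrixP => i j;
by rewrite !mxE.
Qed.

Lemma clifford0 N : clifford (0 : 'cV[K]_(N + N)) = 0.
Proof.
by have := clifford_lin (-1) (0 : 'cV[K]_(N + N)) 0; rewrite scaler0 addr0 scaleN1r addNr.
Qed.
Lemma cliffordZ N a (u : 'cV[K]_(N + N)) : clifford (a *: u) = a *: clifford u.
Proof. by rewrite -[a *: u]addr0 clifford_lin clifford0 addr0. Qed.
Lemma cliffordD N (u v : 'cV[K]_(N + N)) :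
  clifford (u + v) = clifford u + clifford v.
Proof. by rewrite -[u]scale1r clifford_lin !scale1r. Qed.

Lemma cliff_prod_cat N (s t : seq 'cV[K]_(N + N)) :
  cliff_prod (s ++ t) = cliff_prod s *m cliff_prod t.
Proof.
rewrite /cliff_prod; elim: s => [|v s IH]; first by rewrite big_nil mul1mx.
by rewrite !big_cons IH mulmxA.
Qed.

Lemma cliff_prod_rev N (s : seq 'cV[K]_(N + N)) :
  cliff_prod s *m cliff_prod (rev s) = (\prod_(v <- s) qform v)%:M.
Proof.
elim: s => [|v s IH]; first by rewrite /cliff_prod !big_nil mul1mx.
rewrite rev_cons -cats1 cliff_prod_cat {1}/cliff_prod !big_cons.
rewrite -/(cliff_prod s) mulmxA -(mulmxA (clifford v)) IH mul_mx_scalar.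
rewrite /cliff_prod big_cons big_nil mulmx1 -scalemxAl clifford_sqr.
by rewrite scale_scalar_mx mulrC.
Qed.

Fact Spin_1 N : @Spin_pred N 1%:M.
Proof. by apply/asboolP; exists [::]; rewrite /cliff_prod !big_nil. Qed.

Fact Spin_M N (g h : 'M[K]_(spin_dim N)) :
  Spin_pred g -> Spin_pred h -> Spin_pred (g *m h).
Proof.
move=> /asboolP[s [hs ns ->]] /asboolP[t [ht nt ->]]; apply/asboolP.
exists (s ++ t); rewrite size_cat oddD (negbTE hs) (negbTE ht).
by rewrite big_cat /= ns nt mulr1 cliff_prod_cat.
Qed.

Fact Spin_V N (g : 'M[K]_(spin_dim N)) :
  Spin_pred g -> g \in unitmx /\ Spin_pred (invmx g).
Proof.
move=> /asboolP[s [hs ns ->]]; have := cliff_prod_rev s; rewrite ns => E.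
have [us _] := mulmx1_unit E; split=> //; apply/asboolP.
exists (rev s); split; first by rewrite size_rev.
  by rewrite (perm_big s) //= perm_rev.
by rewrite -[RHS](mulKmx us) E mulmx1.
Qed.

Definition Spin_mx (N : nat) : mxGroup (spin_dim N) :=
  MxGroup (@Spin_1 N) (@Spin_M N) (@Spin_V N).

(* The graph of Spin_{2N} ->> SO_{2N}: g maps to A when g v g^-1 = A v for all
   vectors v. *)
Definition spin_cover (N : nat) (g : mxelt (Spin_mx N)) (A : 'M[K]_(N + N)) : Prop :=
  forall v : 'cV[K]_(N + N), mxval g *m clifford v = clifford (A *m v) *m mxval g.

Definition Spin (N : nat) : splitGroup :=
  @SplitGroup (mxAlgGroup (Spin_mx N)) N (fun g s => spin_cover g (diag_torus s)).

(* For 1 <= k <= N, the k-th and the (2N + 1 - k)-th basis vectors. *)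
Definition eps (N k : nat) : 'cV[K]_(N + N) := \col_j (j.+1 == k)%:R.
Definition eps' (N k : nat) : 'cV[K]_(N + N) := \col_j ((j + k)%N == (N + N)%N)%:R.

(* For t <> 0 this is t on e_k /\ Lambda W' and 1 on Lambda W', where W' is spanned
   by the e_j with j <> k; it has norm t, and acts on K^(2N) by diag(.., t, .., t^-1, ..)
   with t at place k. *)
Definition toral (N k : nat) (t : K) : 'M[K]_(spin_dim N) :=
  clifford (t *: eps N k + eps' N k) *m clifford (eps N k + eps' N k).

(* h_alpha (t) = alpha^vee (t) for the simple root alpha = e_k - e_(k+1). *)
Definition h_alpha (N k : nat) (t : K) : 'M[K]_(spin_dim N) :=
  toral N k t *m toral N k.+1 t^-1.

Definition xi1_mx (N : nat) : 'M[K]_(spin_dim N) :=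
  \big[mulmx/1%:M]_(1 <= k < N | odd k) h_alpha N k (-1).

Lemma qform_eps N k t : (0 < k <= N)%N -> qform (t *: eps N k + eps' N k) = t.
Proof.
move=> /andP[k0 kN]; have kN' : (k.-1 < N)%N by lia.
rewrite /qform (bigD1 (Ordinal kN')) //= big1 => [|j jk].
  rewrite !mxE /= prednK // eqxx.
  have -> : ((k.-1 + k)%N == (N + N)%N) = false by apply/eqP; lia.
  have -> : ((N + N - k).+1 == k) = false by apply/eqP; lia.
  have -> : ((N + N - k + k)%N == (N + N)%N) by apply/eqP; lia.
  by rewrite !addr0 mulr1 mulr0 add0r mulr1.
have hj := ltn_ord j; have jk' : (j : nat) != k.-1 by [].
rewrite !mxE /=.
have -> : (j.+1 == k) = false by apply/eqP; lia.
have -> : ((j + k)%N == (N + N)%N) = false by apply/eqP; lia.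
by rewrite mulr0 addr0 mul0r.
Qed.

Definition xi1_seq (N : nat) : seq 'cV[K]_(N + N) :=
  flatten [seq [:: -1 *: eps N k + eps' N k; eps N k + eps' N k;
                   -1 *: eps N k.+1 + eps' N k.+1; eps N k.+1 + eps' N k.+1]
          | k <- index_iota 1 N & odd k].

Lemma xi1_mxE N : xi1_mx N = cliff_prod (xi1_seq N).
Proof.
rewrite /xi1_mx /xi1_seq -big_filter.
elim: [seq _ <- _ | _] => [|k s IH]; first by rewrite /cliff_prod !big_nil.
rewrite big_cons IH /= /cliff_prod !big_cons !mulmxA /h_alpha /toral.
by rewrite invrN1 !mulmxA.
Qed.

Fact Spin_xi1 N : Spin_pred (xi1_mx N).
Proof.
apply/asboolP; exists (xi1_seq N); rewrite xi1_mxE; split=> //.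
  rewrite /xi1_seq; elim: [seq _ <- _ | _] => [|k s IH] //.
  by rewrite /= !negbK.
have : all (fun k => 0 < k < N)%N [seq k <- index_iota 1 N | odd k].
  by apply/allP => k; rewrite mem_filter mem_index_iota => /andP[].
rewrite /xi1_seq; elim: [seq _ <- _ | _] => [_|k s IH] /=; first by rewrite big_nil.
move=> /andP[kN /IH{}IH]; rewrite !big_cons {}IH.
rewrite -[eps N k in X in _ * (X * _)]scale1r.
rewrite -[eps N k.+1 in X in _ * (_ * (_ * (X * _)))]scale1r.
by rewrite !qform_eps; [ring | lia ..].
Qed.

(* Conjugation by M is v |-> (- v_j for j in S, v_j for j not in S). *)
Definition flips N (M : 'M[K]_(spin_dim N)) (S : pred nat) : Prop :=
  forall v : 'cV[K]_(N + N),
    M *m clifford v = clifford (\col_j (if S j then - v j 0 else v j 0)) *m M.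

Lemma flips_ext N (M : 'M[K]_(spin_dim N)) (S S' : pred nat) :
  (forall j, (j < N + N)%N -> S j = S' j) -> flips M S -> flips M S'.
Proof.
move=> hS hM v; rewrite hM; congr (clifford _ *m _); apply/matrixP => i j.
by rewrite !mxE hS.
Qed.

Lemma flips_mul N (M M' : 'M[K]_(spin_dim N)) (S S' : pred nat) :
  flips M S -> flips M' S' -> flips (M *m M') (fun j => S j (+) S' j).
Proof.
move=> hM hM' v; rewrite -mulmxA hM' mulmxA hM -mulmxA.
congr (clifford _ *m _); apply/matrixP => i j; rewrite !mxE.
by case: (S i); case: (S' i); rewrite //= opprK.
Qed.

Definition bform N (u v : 'cV[K]_(N + N)) : K :=
  \sum_(k < N) (u (lshift N k) 0 * v (rev_ord (lshift N k)) 0 +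
                u (rev_ord (lshift N k)) 0 * v (lshift N k) 0).

Lemma clifford_anticomm N (u v : 'cV[K]_(N + N)) :
  clifford u *m clifford v = (bform u v)%:M - clifford v *m clifford u.
Proof.
have := clifford_sqr (u + v); rewrite cliffordD mulmxDl !mulmxDr !clifford_sqr.
have -> : qform (u + v) = qform u + bform u v + qform v.
  by rewrite /qform -!big_split; apply: eq_bigr => k _ /=; rewrite !mxE; ring.
rewrite !raddfD /= !addrA => /addIr; rewrite -!addrA => /addrI /(canRL (addrK _)).
by [].
Qed.

Lemma bform_eps N k t (v : 'cV[K]_(N + N)) (a : 'I_N) : k = a.+1 ->
  bform (t *: eps N k + eps' N k) v =
  t * v (rev_ord (lshift N a)) 0 + v (lshift N a) 0.
Proof.
move=> ->; rewrite /bform (bigD1 a) //= big1 => [|j ja].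
  rewrite !mxE /= eqxx; have ha := ltn_ord a.
  have -> : ((a + a.+1)%N == (N + N)%N) = false by apply/eqP; lia.
  have -> : ((N + N - a.+1).+1 == a.+1) = false by apply/eqP; lia.
  have -> : ((N + N - a.+1 + a.+1)%N == (N + N)%N) by apply/eqP; lia.
  by rewrite !addr0 mulr1 mulr0 add0r mul1r.
have hj := ltn_ord j; have ha := ltn_ord a.
have jk' : (j : nat) != a by [].
rewrite !mxE /=.
have -> : (j.+1 == a.+1) = false by apply/eqP; lia.
have -> : ((j + a.+1)%N == (N + N)%N) = false by apply/eqP; lia.
have -> : ((N + N - j.+1).+1 == a.+1) = false by apply/eqP; lia.
have -> : ((N + N - j.+1 + a.+1)%N == (N + N)%N) = false by apply/eqP; lia.
by rewrite mulr0 addr0 !mul0r addr0.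
Qed.

Definition toral_flip N k : pred nat :=
  fun j => (j.+1 == k) || ((j + k)%N == (N + N)%N).

Section ToralN1.
Variables (N k : nat).
Hypothesis k_bounds : (0 < k <= N)%N.
Let e : 'cV[K]_(N + N) := eps N k + eps' N k.
Let f : 'cV[K]_(N + N) := -1 *: eps N k + eps' N k.

Fact toral_e2 : clifford e *m clifford e = 1%:M.
Proof. by rewrite clifford_sqr /e -[eps N k]scale1r qform_eps. Qed.
Fact toral_f2 : clifford f *m clifford f = - 1%:M.
Proof. by rewrite clifford_sqr qform_eps // raddfN. Qed.
Fact toral_ef : clifford e *m clifford f = - (clifford f *m clifford e).
Proof.
have [a hk] : exists a : 'I_N, k = a.+1.
  have ka : (k.-1 < N)%N by lia.
  by exists (Ordinal ka) => /=; lia.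
have E : e = 1 *: eps N k + eps' N k by rewrite scale1r.
rewrite clifford_anticomm {1}E (bform_eps _ _ hk) /f hk !mxE /= eqxx.
have ha := ltn_ord a.
have -> : ((a + a.+1)%N == (N + N)%N) = false by apply/eqP; lia.
have -> : ((N + N - a.+1).+1 == a.+1) = false by apply/eqP; lia.
have -> : ((N + N - a.+1 + a.+1)%N == (N + N)%N) by apply/eqP; lia.
by rewrite mulr0 mulr1 add0r addr0 mul1r subrr raddf0 add0r.
Qed.

Lemma toralN1_sqr : toral N k (-1) *m toral N k (-1) = 1%:M.
Proof.
rewrite /toral -/e -/f mulmxA -(mulmxA (clifford f)) toral_ef mulmxN mulNmx.
by rewrite mulmxA toral_f2 !mulNmx opprK mul1mx toral_e2.
Qed.

Lemma toralN1_flips : flips (toral N k (-1)) (toral_flip N k).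
Proof.
have [a hk] : exists a : 'I_N, k = a.+1.
  have ka : (k.-1 < N)%N by lia.
  by exists (Ordinal ka) => /=; lia.
have ha := ltn_ord a; move=> v.
have -> : (\col_j (if toral_flip N k j then - v j 0 else v j 0)) =
    - bform e v *: e + (bform f v *: f + v).
  have E : e = 1 *: eps N k + eps' N k by rewrite scale1r.
  rewrite {1}E !(bform_eps _ _ hk) /e.
  apply/matrixP => j c; rewrite ord1 !mxE /toral_flip.
  have hj := ltn_ord j.
  case: eqP => [h1|h1]; case: eqP => [h2|h2] //=; first by lia.
  - have -> : lshift N a = j by apply: val_inj => /=; lia.
    by ring.
  - have -> : rev_ord (lshift N a) = j by apply: val_inj => /=; lia.
    by ring.
  - by ring.
have ev := clifford_anticomm e v; have fv := clifford_anticomm f v.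
have efe : clifford e *m (clifford f *m clifford e) = - clifford f.
  by rewrite mulmxA toral_ef mulNmx -mulmxA toral_e2 mulmx1.
have ffe : clifford f *m (clifford f *m clifford e) = - clifford e.
  by rewrite mulmxA toral_f2 mulNmx mul1mx.
rewrite (clifford_lin _ e) (clifford_lin _ f v) /toral -/e -/f -[LHS]mulmxA ev mulmxBr.
rewrite (mulmxA (clifford f) (clifford v)) fv mulmxBl opprB !mulmxDl.
rewrite -!scalemxAl efe ffe mul_mx_scalar mul_scalar_mx !scaleNr !scalerN opprK.
by rewrite -(mulmxA (clifford v)) [clifford v *m _ - _]addrC.
Qed.

Lemma flips_toralN1 (M : 'M[K]_(spin_dim N)) (S : pred nat) : flips M S ->
  (forall j, toral_flip N k j -> S j = false) ->
  M *m toral N k (-1) = toral N k (-1) *m M.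
Proof.
move=> hM hS; rewrite /toral -/e -/f.
have E (u : 'cV[K]_(N + N)) :
    (forall j : 'I_(N + N), ~~ toral_flip N k j -> u j 0 = 0) ->
    M *m clifford u = clifford u *m M.
  move=> hu; rewrite hM; congr (clifford _ *m _); apply/matrixP => j c.
  rewrite ord1 mxE; case: (boolP (toral_flip N k j)) => h; first by rewrite hS.
  by rewrite hu // oppr0 if_same.
have Ef : M *m clifford f = clifford f *m M.
  apply: E => j; rewrite /toral_flip negb_or !mxE => /andP[/negbTE-> /negbTE->].
  by rewrite mulr0 addr0.
have Ee : M *m clifford e = clifford e *m M.
  apply: E => j; rewrite /toral_flip negb_or !mxE => /andP[/negbTE-> /negbTE->].
  by rewrite addr0.
by rewrite mulmxA Ef -[LHS]mulmxA Ee mulmxA.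
Qed.
End ToralN1.

Lemma odd_iota_rcons p :
  [seq k <- index_iota 1 (2 * p.+1) | odd k] =
  [seq k <- index_iota 1 (2 * p) | odd k] ++ [:: (2 * p).+1].
Proof.
case: p => [//|p]; rewrite /index_iota.
have -> : (2 * p.+2 - 1 = (2 * p.+1 - 1) + 2)%N by lia.
rewrite iotaD filter_cat; congr (_ ++ _).
have -> : (1 + (2 * p.+1 - 1) = 2 * p.+1)%N by lia.
have hq : odd (2 * p.+1) = false by rewrite oddM.
by move: (2 * p.+1)%N hq => q hq; rewrite /= hq.
Qed.

Lemma xi1_partial N p : (2 * p <= N)%N ->
  let M := \big[mulmx/1%:M]_(1 <= k < 2 * p | odd k) h_alpha N k (-1) in
  flips M (fun j => (j < 2 * p)%N || (N + N <= j + 2 * p)%N) /\ M *m M = 1%:M.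
Proof.
elim: p => [_ | p IH hp] /=.
  rewrite big_geq //; split; last by rewrite mul1mx.
  move=> v; rewrite mul1mx mulmx1; congr clifford; apply/matrixP => i j.
  by rewrite ord1 mxE ifF //; have := ltn_ord i; lia.
have h2p : (2 * p <= N)%N by lia.
have [hM M2] := IH h2p.
set D := toral N (2 * p).+1 (-1); set D' := toral N (2 * p).+2 (-1).
have -> : \big[mulmx/1%:M]_(1 <= k < 2 * p.+1 | odd k) h_alpha N k (-1) =
    \big[mulmx/1%:M]_(1 <= k < 2 * p | odd k) h_alpha N k (-1) *m (D *m D').
  rewrite -big_filter odd_iota_rcons -[in RHS]big_filter.
  elim: [seq k <- index_iota _ _ | _] => [|k s IHs] /=.
    by rewrite big_cons !big_nil mul1mx mulmx1 /h_alpha invrN1.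
  by rewrite !big_cons IHs !mulmxA.
move: hM M2; set M := \big[_/_]_(_ <= _ < _ | _) _ => hM M2.
have kD : (0 < (2 * p).+1 <= N)%N by lia.
have kD' : (0 < (2 * p).+2 <= N)%N by lia.
have DD' : D *m D' = D' *m D.
  have := @flips_toralN1 N (2 * p).+2 _ _ (toralN1_flips kD); apply=> j.
  by rewrite /toral_flip; lia.
have MD : M *m D = D *m M.
  by have := @flips_toralN1 N (2 * p).+1 _ _ hM; apply=> j; rewrite /toral_flip; lia.
have MD' : M *m D' = D' *m M.
  by have := @flips_toralN1 N (2 * p).+2 _ _ hM; apply=> j; rewrite /toral_flip; lia.
split.
  apply: flips_ext (flips_mul hM (flips_mul (toralN1_flips kD) (toralN1_flips kD'))).
  by move=> j hj; rewrite /toral_flip; lia.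
have ME : M *m (D *m D') = D *m D' *m M by rewrite mulmxA MD -mulmxA MD' mulmxA.
have EE : D *m D' *m (D *m D') = 1%:M.
  by rewrite -mulmxA (mulmxA D' D) -DD' -(mulmxA D) !toralN1_sqr // mulmx1 toralN1_sqr.
by rewrite {1}ME -mulmxA (mulmxA M) M2 mul1mx EE.
Qed.

Lemma xi1_anticomm r (v : 'cV[K]_(2 * r + 2 * r)) :
  xi1_mx (2 * r)%N *m clifford v = - (clifford v *m xi1_mx (2 * r)%N).
Proof.
have [h _] := @xi1_partial (2 * r)%N r (leqnn _).
rewrite [LHS]h -mulNmx -[in RHS]scaleN1r -cliffordZ; congr (clifford _ *m _).
apply/matrixP => i j; rewrite ord1 !mxE mulN1r ifT //.
by have := ltn_ord i; lia.
Qed.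

Fact xi1_sqr r : xi1_mx (2 * r)%N *m xi1_mx (2 * r)%N = 1%:M.
Proof. by have [_] := @xi1_partial (2 * r)%N r (leqnn _). Qed.

Definition xi1 (r : nat) : Spin (2 * r)%N :=
  @MxElt _ (Spin_mx (2 * r)%N) _ (Spin_xi1 (2 * r)%N).

Fact xi1C r (g : Spin (2 * r)%N) : (g * xi1 r = xi1 r * g)%g.
Proof.
apply: val_inj => /=; case: g => g /= /asboolP[s [hs _ ->]].
have E (t : seq 'cV[K]_(2 * r + 2 * r)) : xi1_mx (2 * r)%N *m cliff_prod t =
    (-1) ^+ size t *: (cliff_prod t *m xi1_mx (2 * r)%N).
  rewrite /cliff_prod; elim: t => [|v t IH].
    by rewrite big_nil mulmx1 mul1mx scale1r.
  rewrite !big_cons mulmxA xi1_anticomm mulNmx -(mulmxA _ (xi1_mx _)) IH /=.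
  by rewrite -scalemxAr exprS -scalerA scaleN1r mulmxA.
by rewrite E -signr_odd (negbTE hs) scale1r.
Qed.

Fact xi1M r : (xi1 r * xi1 r = 1)%g.
Proof. by apply: val_inj => /=; rewrite xi1_sqr. Qed.

(* HSpin r is HSpin_{4r} = Spin_{4r} / {1, xi1}. *)
Definition HSpin (r : nat) : splitGroup :=
  quotSG (CentralInv (@xi1C r) (xi1M r)).

Fact kron_dim n m : ((n + n) * (m + m) = 2 * (n * m) + 2 * (n * m))%N.
Proof. by lia. Qed.

Definition kron n m (A : 'M[K]_(n + n)) (B : 'M[K]_(m + m)) :
    'M[K]_(2 * (n * m) + 2 * (n * m)) :=
  castmx (kron_dim n m, kron_dim n m) (A *t B).

Definition J_mx m : 'M[K]_(m + m) := block_mx 1%:M 0 0 (- Omega m).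
Definition K_mx m : 'M[K]_(m + m) := block_mx (Omega m) 0 0 1%:M.

(* The block diagonal matrix with n blocks J followed by n blocks K. *)
Definition P_mx n m : 'M[K]_(2 * (n * m) + 2 * (n * m)) :=
  kron (block_mx 1%:M 0 0 0) (J_mx m) + kron (block_mx 0 0 0 1%:M) (K_mx m).

Definition rho_SO n m (A : SO n) (B : SO m) := kron (mxval A) (mxval B).
Definition rho_Sp n m (A : Sp n) (B : Sp m) :=
  invmx (P_mx n m) *m kron (mxval A) (mxval B) *m P_mx n m.

Definition lifts_rho_Sp n m
    (phi : prodSG (Sp n) (Sp m) -> Spin (2 * (n * m))%N) : Prop :=
  alg_hom phi /\
  forall (A : Sp n) (B : Sp m), spin_cover (phi (A, B)) (rho_Sp A B).

Definition lifts_rho_SO n m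
    (phi : prodSG (Spin n) (Spin m) -> Spin (2 * (n * m))%N) : Prop :=
  alg_hom phi /\
  forall (g : Spin n) (h : Spin m) (A : SO n) (B : SO m),
    spin_cover g (mxval A) -> spin_cover h (mxval B) ->
    spin_cover (phi (g, h)) (rho_SO A B).

Definition to_PSp n (A : Sp n) : PSp n := quot2_proj _ A.
Definition to_PSO n (A : SO n) : PSO n := quot2_proj _ A.
Definition to_HSpin r (g : Spin (2 * r)%N) : HSpin r := quot2_proj _ g.

Definition induced_Sp n m
    (phi : prodSG (Sp n) (Sp m) -> Spin (2 * (n * m))%N)
    (phi' : prodSG (PSp n) (PSp m) -> HSpin (n * m)%N) : Prop :=
  alg_hom phi' /\
  forall (A : Sp n) (B : Sp m),
    phi' (to_PSp A, to_PSp B) = to_HSpin (phi (A, B)).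

(* The map Spin_{2n} x Spin_{2m} ->> PSO_{2n} x PSO_{2m} goes through SO_{2n} x SO_{2m}. *)
Definition induced_SO n m
    (phi : prodSG (Spin n) (Spin m) -> Spin (2 * (n * m))%N)
    (phi' : prodSG (PSO n) (PSO m) -> HSpin (n * m)%N) : Prop :=
  alg_hom phi' /\
  forall (g : Spin n) (h : Spin m) (A : SO n) (B : SO m),
    spin_cover g (mxval A) -> spin_cover h (mxval B) ->
    phi' (to_PSO A, to_PSO B) = to_HSpin (phi (g, h)).

End AlgebraicGroups.

Definition sum_sqr (r : nat) : {mpoly rat[r]} := \sum_(i < r) 'X_i ^+ 2.

Definition kappa (r : nat) : rat :=
  if (4 %| r)%N then 1 else if (2 %| r)%N then 2 else 4.
Definition lambda (r : nat) : rat :=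
  if (4 %| r)%N then 2^-1 else if (2 %| r)%N then 1 else 2.

(* In terms of the rank r of PSp_{2r} and PSO_{2r}, and of r for HSpin_{4r}. *)
Definition q_PSp (r : nat) : {mpoly rat[r]} := kappa r *: sum_sqr r.
Definition q_PSO (r : nat) : {mpoly rat[r]} := kappa r *: sum_sqr r.
Definition q_HSpin (r : nat) : {mpoly rat[2 * r]} := lambda r *: sum_sqr (2 * r)%N.

(* All divisions are exact.  The default case covers the entries that do not occur,
   n and m both odd. *)
Definition rost_table (n m : nat) : nat * nat :=
  match (n %% 4)%N, (m %% 4)%N with
  | 0, 0 => (m, n)
  | 0, 1 => (m, n %/ 4)
  | 0, 2 => (m, n %/ 2)
  | 0, 3 => (m, n %/ 4)
  | 1, 0 => (m %/ 4, n)
  | 1, 2 => (m %/ 2, n)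
  | 2, 0 => (m %/ 2, n)
  | 2, 1 => (m, n %/ 2)
  | 2, 2 => (m %/ 2, n %/ 2)
  | 2, 3 => (m, n %/ 2)
  | 3, 0 => (m %/ 4, n)
  | 3, 2 => (m %/ 2, n)
  | _, _ => (0, 0)
  end%N.

(* Main.v *)
(* On the tori, [phi_Sp'] and [phi_{2n,2m}'] pull the weights of [HSpin_{4nm}] back
   along [e_k |-> e_i + eta_j], where [eta] lists the weights [+-f_1 .. +-f_m] of the
   second factor in an order depending on the map. As [sum_j eta_j = 0] and
   [sum_j eta_j^2 = 2 sum_j f_j^2], both send [sum_k e_k^2] to
   [2m sum_i e_i^2 + 2n sum_j f_j^2]; the table follows by comparing the normalising
   constants, and the image of [q_HSpin] under [phi^dagger] is unique.

   That the quadratic forms lie in [S^2(T^* )^W] requires regular functions over [F]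
   restricting to the characters involved. Products of two diagonal entries serve for
   [PSp] and [PSO], and the diagonal entries of the half-spin representation for
   [HSpin]. If [w] normalises [T], then [t w = w (t^w)], so a nonzero entry [w_(j,i)]
   shows that conjugation by [w] carries the [i]-th diagonal entry to the [j]-th:
   these characters are permuted. *)
From HB Require Import structures.
Require Import Defs.
From mathcomp Require Import all_boot all_order all_algebra.
From mathcomp Require Import mxtens zify ring.
From mathcomp Require Import boolp.
From mathcomp Require Import mpoly.
Set Implicit Arguments.
Unset Strict Implicit.
Unset Printing Implicit Defensive.

Import GRing.Theory Num.Theory.
Local Open Scope ring_scope.

(** * Monomials and quadratic forms *)

(** Invariance under [W] is tested on [K]-points [w] normalising [T], and conjugation by such a
    point need not preserve the functions regular over [F]. It is therefore not enough that [w] acts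
    on exponents by a matrix fixing the form: every composed character must be identified, on the
    torus, with an explicit [F]-regular one. For the maps [phi'] this is automatic, as they are
    algebraic over [F]. Torus coordinates form only a relation, and weights are rational vectors
    known up to passing to a multiple, so an integral matrix [M] of exponents stands in for the
    pull-back of characters. Nonzero points of [K] separate monomials; hence any image of a form is
    its substitution by [M], whatever presentation was used. Existence becomes the task of writing
    the form as an integral combination of products of available weights. The delicate case is the
    coefficient 1/2 for [HSpin], where the half-sum of all [e_i] is needed besides the differences
    [e_i - e_m] and [2 e_m]. *)

Section Monomials.
Variable K : closedFieldType.

Lemma exprz_inj (a b : int) :
  (forall x : K, x != 0 -> x ^ a = x ^ b) -> a = b.
Proof.
move=> h; have {}h (x : K) : x != 0 -> x ^+ `|a - b|%N = 1.
  move=> x0; have := h x x0 => /(congr1 ( *%R^~ (x ^ (- b)))).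
  rewrite -!expfzDr // subrr expr0z => E.
  case: (a - b) E => [k|k] //=; rewrite NegzE -exprnN => /eqP.
  by rewrite invr_eq1 => /eqP.
apply/eqP; rewrite -subr_eq0 -absz_eq0; apply/eqP.
case E: `|a - b|%N => [//|k]; rewrite E in h.
(* A root of [X^(k+2) = X - 1] is nonzero; together with [x^(k+1) = 1] the equation reads
   [x = x - 1]. *)
have [x hx] := @solve_monicpoly K k.+2
  (fun i => if i == 0%N then - 1 else if i == 1%N then 1 else 0) isT.
rewrite !big_ord_recl /= expr0 expr1 big1 ?addr0 in hx; last first.
  by move=> i _; rewrite mul0r.
have x0 : x != 0.
  apply/eqP => x0; move: hx; rewrite x0 expr0n /= mulr0 mulr1 addr0 => /eqP.
  by rewrite eq_sym oppr_eq0 oner_eq0.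
move: hx; rewrite exprS h // mulr1 mul1r mulr1 => /eqP.
by rewrite -[X in X == _]add0r (inj_eq (addIr _)) eq_sym oppr_eq0 oner_eq0.
Qed.

Definition nz r (s : 'rV[K]_r) := forall i, s 0 i != 0.

Definition monom r (s : 'rV[K]_r) (z : 'rV[int]_r) : K := \prod_i s 0 i ^ z 0 i.

(** Rows of [M] are the exponents of the new coordinates, so pulling back a monomial multiplies its
    exponent vector by [M] on the right. *)
Definition monmap r r' (s : 'rV[K]_r) (M : 'M[int]_(r', r)) : 'rV[K]_r' :=
  \row_i monom s (row i M).

Lemma monom_neq0 r (s : 'rV[K]_r) z : nz s -> monom s z != 0.
Proof. by move=> hs; apply/prodf_neq0 => i _; rewrite expfz_neq0. Qed.

Lemma monom0 r (s : 'rV[K]_r) : monom s 0 = 1.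
Proof. by rewrite /monom big1 // => i _; rewrite mxE expr0z. Qed.

Lemma monomD r (s : 'rV[K]_r) z z' : nz s ->
  monom s (z + z') = monom s z * monom s z'.
Proof.
by move=> hs; rewrite -big_split; apply: eq_bigr => i _; rewrite mxE expfzDr.
Qed.

Lemma monomZ r (s : 'rV[K]_r) a z : monom s (a *: z) = monom s z ^ a.
Proof.
rewrite /monom; elim/big_ind2: _ => [|x x' y y' -> ->|i _].
- by rewrite exp1rz.
- by rewrite expfzMl.
- by rewrite mxE mulrC exprz_exp.
Qed.

Lemma monomN r (s : 'rV[K]_r) z : monom s (- z) = (monom s z)^-1.
Proof. by rewrite -scaleN1r monomZ. Qed.

Lemma monom_delta r (s : 'rV[K]_r) i : monom s (delta_mx 0 i) = s 0 i.
Proof.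
rewrite /monom (bigD1 i) //= big1 => [|j ji]; rewrite !mxE eqxx.
  by rewrite eqxx mulr1 expr1z.
by rewrite (negbTE ji) expr0z.
Qed.

Lemma monom_sum r (s : 'rV[K]_r) I (P : seq I) (f : I -> 'rV[int]_r) : nz s ->
  monom s (\sum_(i <- P) f i) = \prod_(i <- P) monom s (f i).
Proof.
move=> hs; elim: P => [|i P IH]; first by rewrite !big_nil monom0.
by rewrite !big_cons monomD // IH.
Qed.

Lemma monom_mulmx r r' (s : 'rV[K]_r) (M : 'M[int]_(r', r)) z : nz s ->
  monom (monmap s M) z = monom s (z *m M).
Proof.
move=> hs; rewrite mulmx_sum_row monom_sum //; apply: eq_bigr => i _.
by rewrite mxE monomZ.
Qed.

Lemma monom_inj r (z z' : 'rV[int]_r) :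
  (forall s : 'rV[K]_r, nz s -> monom s z = monom s z') -> z = z'.
Proof.
move=> h; apply/rowP => i; apply: exprz_inj => x x0.
pose s : 'rV[K]_r := \row_j if j == i then x else 1.
have E w : monom s w = x ^ w 0 i.
  rewrite /monom (bigD1 i) //= big1 => [|j ji]; rewrite mxE ?eqxx ?mulr1 //.
  by rewrite (negbTE ji) exp1rz.
by rewrite -!E h // => j; rewrite mxE; case: ifP => _ //; apply: oner_neq0.
Qed.

End Monomials.

Definition ratmx r r' (M : 'M[int]_(r, r')) : 'M[rat]_(r, r') := map_mx intr M.

Lemma ratmxM p q r (A : 'M[int]_(p, q)) (B : 'M[int]_(q, r)) :
  ratmx (A *m B) = ratmx A *m ratmx B.
Proof. exact: map_mxM. Qed.

Lemma ratmxD p q (A B : 'M[int]_(p, q)) : ratmx (A + B) = ratmx A + ratmx B.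
Proof. exact: map_mxD. Qed.

Lemma ratmx0 p q : ratmx (0 : 'M[int]_(p, q)) = 0.
Proof. exact: map_mx0. Qed.

Lemma ratmx_sum p q I (s : seq I) (f : I -> 'M[int]_(p, q)) :
  ratmx (\sum_(i <- s) f i) = \sum_(i <- s) ratmx (f i).
Proof. exact: (big_morph _ (@ratmxD p q) (ratmx0 p q)). Qed.

Lemma ratmxN p q (A : 'M[int]_(p, q)) : ratmx (- A) = - ratmx A.
Proof. exact: map_mxN. Qed.

Lemma ratmx_delta p q i j : ratmx (delta_mx i j : 'M_(p, q)) = delta_mx i j.
Proof. exact: map_delta_mx. Qed.

Section Forms.

Lemma linear_form_is_linear r : linear (@linear_form r).
Proof.
move=> a u v; rewrite /linear_form scaler_sumr -big_split; apply: eq_bigr => i _.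
by rewrite !mxE scalerDl scalerA.
Qed.
HB.instance Definition _ r := GRing.isLinear.Build rat 'rV[rat]_r {mpoly rat[r]}
  *:%R (@linear_form r) (@linear_form_is_linear r).

Lemma linear_form_delta r i : linear_form (delta_mx 0 i : 'rV_r) = 'X_i.
Proof.
rewrite /linear_form (bigD1 i) //= big1 => [|j ji]; rewrite !mxE eqxx.
  by rewrite eqxx scale1r addr0.
by rewrite (negbTE ji) scale0r.
Qed.

Lemma linear_form_l r1 r2 (u : 'rV[rat]_r1) :
  linear_form u \mPo [tuple 'X_(lshift r2 i) | i < r1] =
  linear_form (row_mx u (0 : 'rV_r2)).
Proof.
rewrite /linear_form big_split_ord /= [X in _ + X]big1 ?addr0 => [|i _].
  rewrite raddf_sum; apply: eq_bigr => i _ /=.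
  by rewrite comp_mpolyZ comp_mpolyXU -tnth_nth tnth_mktuple row_mxEl.
by rewrite row_mxEr mxE scale0r.
Qed.

Lemma linear_form_r r1 r2 (u : 'rV[rat]_r2) :
  linear_form u \mPo [tuple 'X_(rshift r1 i) | i < r2] =
  linear_form (row_mx (0 : 'rV_r1) u).
Proof.
rewrite /linear_form big_split_ord /= [X in X + _]big1 ?add0r => [|i _].
  rewrite raddf_sum; apply: eq_bigr => i _ /=.
  by rewrite comp_mpolyZ comp_mpolyXU -tnth_nth tnth_mktuple row_mxEr.
by rewrite row_mxEl mxE scale0r.
Qed.

(** This is [S^2] of the linear map [u |-> u *m M], extended to all polynomials. *)
Definition subst_mx r r' (M : 'M[rat]_(r, r')) (Q : {mpoly rat[r]}) :
  {mpoly rat[r']} := Q \mPo [tuple linear_form (row i M) | i < r].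

Lemma subst_mxD r r' (M : 'M[rat]_(r, r')) Q Q' :
  subst_mx M (Q + Q') = subst_mx M Q + subst_mx M Q'.
Proof. exact: comp_mpolyD. Qed.
Lemma subst_mxM r r' (M : 'M[rat]_(r, r')) Q Q' :
  subst_mx M (Q * Q') = subst_mx M Q * subst_mx M Q'.
Proof. exact: rmorphM. Qed.
Lemma subst_mxZ r r' (M : 'M[rat]_(r, r')) c Q :
  subst_mx M (c *: Q) = c *: subst_mx M Q.
Proof. exact: comp_mpolyZ. Qed.
Lemma subst_mx_sum r r' (M : 'M[rat]_(r, r')) (I : Type) (s : seq I) (f : I -> _) :
  subst_mx M (\sum_(i <- s) f i) = \sum_(i <- s) subst_mx M (f i).
Proof. exact: raddf_sum. Qed.
Lemma subst_mxX r r' (M : 'M[rat]_(r, r')) i :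
  subst_mx M 'X_i = linear_form (row i M).
Proof. by rewrite /subst_mx comp_mpolyXU -tnth_nth tnth_mktuple. Qed.

Lemma subst_linear_form r r' (M : 'M[rat]_(r, r')) u :
  subst_mx M (linear_form u) = linear_form (u *m M).
Proof.
rewrite {1}/linear_form subst_mx_sum mulmx_sum_row raddf_sum.
by apply: eq_bigr => i _; rewrite subst_mxZ subst_mxX /= linearZ.
Qed.

Lemma subst_sum_sqr r r' (M : 'M[rat]_(r, r')) :
  subst_mx M (sum_sqr r) = \sum_i linear_form (row i M) ^+ 2.
Proof.
by rewrite subst_mx_sum; apply: eq_bigr => i _; rewrite expr2 subst_mxM !subst_mxX.
Qed.

(** The source side of [S2_map] with a free predicate in place of weights: [W] will hold the weights
    whose transform is again a weight. Integer coefficients arise by repetition and from negatives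
    in [W]. *)
Inductive quad_span r (W : 'rV[rat]_r -> Prop) : {mpoly rat[r]} -> Prop :=
| quad_span0 : quad_span W 0
| quad_span_step Q u v of quad_span W Q & W u & W v :
    quad_span W (Q + linear_form u * linear_form v).

Section Span.
Variables (r : nat) (W : 'rV[rat]_r -> Prop).

Lemma quad_spanM u v : W u -> W v -> quad_span W (linear_form u * linear_form v).
Proof. by move=> hu hv; rewrite -[_ * _]add0r; do !constructor. Qed.

Lemma quad_spanD Q Q' : quad_span W Q -> quad_span W Q' -> quad_span W (Q + Q').
Proof.
move=> hQ; elim=> [|P u v _ IH hu hv]; first by rewrite addr0.
by rewrite addrA; constructor.
Qed.

Lemma quad_span_sum (I : Type) (s : seq I) (f : I -> {mpoly rat[r]}) :
  (forall i, quad_span W (f i)) -> quad_span W (\sum_(i <- s) f i).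
Proof.
move=> h; elim: s => [|i s IH]; first by rewrite big_nil; constructor.
by rewrite big_cons; apply: quad_spanD.
Qed.

Lemma quad_spanMn Q k : quad_span W Q -> quad_span W (Q *+ k).
Proof.
move=> h; elim: k => [|k IH]; first by rewrite mulr0n; constructor.
by rewrite mulrS; apply: quad_spanD.
Qed.

Hypothesis W_opp : forall u, W u -> W (- u).

Lemma quad_spanN Q : quad_span W Q -> quad_span W (- Q).
Proof.
elim=> [|P u v _ IH hu hv]; first by rewrite oppr0; constructor.
rewrite opprD -mulNr -raddfN; constructor; by [|exact: W_opp].
Qed.
End Span.

Variables (r : nat) (W : 'rV[rat]_r -> Prop).
Variable m : 'I_r.
Let e i : 'rV[rat]_r := delta_mx 0 i.
Hypothesis W_root : forall i, W (e i - e m).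
Hypothesis W_two : W (e m *+ 2).

Lemma sum_sqr_shift (f : {mpoly rat[r]}) : sum_sqr r =
  \sum_i ('X_i - f) ^+ 2 + f *+ 2 * \sum_i ('X_i - f) + f ^+ 2 *+ r.
Proof.
have -> : f ^+ 2 *+ r = \sum_(i < r) f ^+ 2.
  by rewrite sumr_const cardT size_enum_ord.
by rewrite mulr_sumr -!big_split; apply: eq_bigr => i _ /=; ring.
Qed.

(** Expanding about [e_m] leaves products of the vectors [e_i - e_m] and [2 e_m], plus [k r e_m^2];
    as [k r = 4 c], the latter is [c (2 e_m)^2]. *)
Lemma quad_span_root k c : k *+ r = (4 * c)%:R :> rat -> k \is a Num.nat ->
  quad_span W (k *: sum_sqr r).
Proof.
move=> kc /natrP[k' Ek].
rewrite (sum_sqr_shift 'X_m) Ek scaler_nat !mulrnDl.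
have E i : 'X_i - 'X_m = linear_form (e i - e m).
  by rewrite raddfB /= !linear_form_delta.
have E2 : 'X_m *+ 2 = linear_form (e m *+ 2).
  by rewrite raddfMn /= linear_form_delta.
apply: quad_spanD; first apply: quad_spanD.
- apply: quad_spanMn; apply: quad_span_sum => i; rewrite E expr2.
  exact: quad_spanM.
- apply: quad_spanMn; rewrite mulr_sumr; apply: quad_span_sum => i.
  by rewrite E E2; apply: quad_spanM.
rewrite -mulrnA.
have -> : (r * k' = 4 * c)%N.
  by apply/eqP; rewrite -(eqr_nat rat) natrM -Ek mulr_natl kc.
have -> : 'X_m ^+ 2 *+ (4 * c) =
    ('X_m *+ 2) * ('X_m *+ 2) *+ c :> {mpoly rat[r]} by ring.
by apply: quad_spanMn; rewrite E2; apply: quad_spanM.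
Qed.

Hypothesis W_add : forall u v, W u -> W v -> W (u + v).
Hypothesis W_opp : forall u, W u -> W (- u).
Let omega : 'rV[rat]_r := const_mx 2^-1.
Hypothesis W_omega : W omega.

(** Trades a sum of squares, which will carry the coefficient [l / 2], for the square of the sum and
    an even multiple of mixed products. *)
Lemma sqr_sum (R : comNzRingType) (d : nat -> R) k :
  (\sum_(i < k) d i) ^+ 2 =
  \sum_(i < k) d i ^+ 2 + (\sum_(i < k) d i * \sum_(j < i) d j) *+ 2.
Proof.
elim: k => [|k IH]; first by rewrite !big_ord0 expr0n mul0rn addr0.
by rewrite !big_ord_recr /= sqrrD IH; ring.
Qed.

Lemma quad_span_spin k l q c : k = l%:R / 2 -> r = (4 * q)%N ->
  (l * q = 2 * c)%N -> quad_span W (k *: sum_sqr r).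
Proof.
move=> Ek Er Ec; pose f : {mpoly rat[r]} := 'X_m.
(* [d] is indexed by [nat], with value 0 out of range, to fit the inner sums over [j < i] in
   [sqr_sum]. *)
pose d i : {mpoly rat[r]} := oapp (fun j : 'I_r => 'X_j - f) 0 (insub i).
pose h := omega - (e m *+ 2) *+ q.
have W0 : W 0 by rewrite -(subrr (e m *+ 2)); apply: W_add; last exact: W_opp.
have W_sum (I : Type) (s : seq I) g : (forall i, W (g i)) -> W (\sum_(i <- s) g i).
  by move=> hv; elim/big_ind: _ => // *; apply: W_add.
have Wh : W h.
  apply: W_add => //; apply: W_opp; elim: (q) => [|j IH] //.
  by rewrite mulrS; apply: W_add.
have EN (x : {mpoly rat[r]}) : x *+ r = x *+ (4 * q) by congr (x *+ _).
have dE (i : 'I_r) : d i = 'X_i - f by rewrite /d valK.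
have [v Wv Ed] : exists2 v : nat -> 'rV_r, forall i, W (v i) &
    forall i, d i = linear_form (v i).
  exists (fun i => oapp (fun j : 'I_r => e j - e m) 0 (insub i)) => i.
    by case: insub.
  rewrite /d; case: insub => [j|] /=; last by rewrite raddf0.
  by rewrite raddfB /= !linear_form_delta.
have E2 : f *+ 2 = linear_form (e m *+ 2).
  by rewrite raddfMn /= linear_form_delta.
have Eh : \sum_(i < r) d i = linear_form h *+ 2.
  under eq_bigr do rewrite dE.
  rewrite sumrB sumr_const cardT size_enum_ord EN.
  have -> : \sum_(i < r) 'X_i = linear_form omega *+ 2.
    rewrite -raddfMn; apply: eq_bigr => i _.
    by rewrite mulmxnE mxE (_ : 2^-1 *+ 2 = 1 :> rat) ?scale1r.
  rewrite /h raddfB /= [linear_form (_ *+ q)]raddfMn /= -E2; ring.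
(* With [d_i = e_i - e_m], [g = 2 e_m], [omega = 1/2 sum_i e_i] and
   [h = omega - (r/4) g] one has [sum_i d_i = 2 h], whence
   [k sum_i e_i^2 = 2l h^2 - l sum_(j < i) d_j d_i + l g h + c g^2]. *)
have -> : k *: sum_sqr r = linear_form h * linear_form h *+ (2 * l)
     - (\sum_(i < r) d i * \sum_(j < i) d j) *+ l
     + f *+ 2 * linear_form h *+ l + f *+ 2 * (f *+ 2) *+ c.
  rewrite (sum_sqr_shift f).
  have E : \sum_i ('X_i - f) = \sum_(i < r) d i.
    by apply: eq_bigr => i _; rewrite dE.
  have E' : \sum_i ('X_i - f) ^+ 2 = \sum_(i < r) d i ^+ 2.
    by apply: eq_bigr => i _; rewrite dE.
  rewrite {}E {}E'; have := sqr_sum d r; rewrite Eh.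
  move: (\sum_(i < _) _ ^+ 2) (\sum_(i < _) _ * _) => D C.
  move/esym/(canRL (addrK _)) => ->.
  (* Doubling clears the denominator of [k = l / 2]. *)
  apply: (scalerI (_ : 2 != 0 :> rat)) => //.
  rewrite scalerA Ek [2 * _]mulrC mulfVK // !scaler_nat EN 2!mulrnDl.
  rewrite -[f ^+ 2 *+ _ *+ l]mulrnA -mulnA [(q * l)%N]mulnC Ec.
  ring.
have WM u v' : W u -> W v' -> quad_span W (linear_form u * linear_form v').
  exact: quad_spanM.
apply: quad_spanD; last by rewrite E2; apply/quad_spanMn/WM.
apply: quad_spanD; last by rewrite E2; apply/quad_spanMn/WM.
apply: quad_spanD; first by apply/quad_spanMn/WM.
apply/quad_spanN => //; apply/quad_spanMn/quad_span_sum => i.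
rewrite Ed; under eq_bigr do rewrite Ed.
by rewrite -raddf_sum; apply: WM => //; apply: W_sum.
Qed.

End Forms.

(** * Weights and S^2 of the character lattice *)

Section Weights.
Variables (F : fieldType) (K : closedFieldType) (iota : {rmorphism F -> K}).
Local Notation algGroup := (algGroup K).
Local Notation splitGroup := (splitGroup K).

Definition torus_nz (G : splitGroup) :=
  forall (t : G) s, torus_coord t s -> nz s.

Definition torus_onto (G : splitGroup) :=
  forall s, nz s -> exists t : G, torus_coord t s.

Definition torus_morph (G H : splitGroup) (phi : G -> H)
    (M : 'M[int]_(rank H, rank G)) :=
  forall t s, torus_coord t s -> torus_coord (phi t) (monmap s M).

Lemma has_weightP (G : splitGroup) (chi : G -> K) (v : 'rV[rat]_(rank G)) :
  has_weight chi v <-> torus_char chi /\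
  exists (k : nat) (z : 'rV[int]_(rank G)),
    [/\ (0 < k)%N, v *+ k = ratmx z
      & forall t s, torus_coord t s -> chi t ^+ k = monom s z].
Proof.
split=> -[hc [k [z [k0 hz ht]]]]; split=> //.
  exists k, (\row_i z i); split=> //.
    by apply/rowP => i; rewrite mulmxnE !mxE -hz mulr_natl.
  by move=> t s /ht ->; apply: eq_bigr => i _; rewrite mxE.
exists k, (fun i => z 0 i); split=> // i.
by rewrite mulr_natl -mulmxnE hz mxE.
Qed.

(** That the composite is a torus character is a hypothesis because [phi] may be conjugation by a
    [K]-point, under which regularity over [F] has to be proved separately. *)
Lemma has_weight_comp (G H : splitGroup) (phi : G -> H) M chi u :
    torus_nz G -> torus_morph phi M -> torus_char (chi \o phi) ->
  has_weight chi u -> has_weight (chi \o phi) (u *m ratmx M).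
Proof.
move=> G_nz hM hc /has_weightP[_ [k [z [k0 hz ht]]]]; apply/has_weightP.
split=> //; exists k, (z *m M); split=> //.
  by rewrite ratmxM -hz -!scaler_nat scalemxAl.
move=> t s hs; rewrite /= (ht _ _ (hM _ _ hs)) monom_mulmx //; exact: G_nz hs.
Qed.

Lemma torus_char_comp (G H : splitGroup) (phi : G -> H) M chi :
    alg_hom phi -> torus_morph phi M -> torus_char chi ->
  torus_char (chi \o phi).
Proof.
move=> [phiM phi_reg] hM [[f f_reg fE] chi1 chiM].
have phi_t t : in_torus t -> in_torus (phi t) by move=> [s /hM]; exists (monmap s M).
split=> [||t u ht hu] /=.
- by exists (f \o phi); [exact: phi_reg | move=> t /phi_t /fE].
- have -> // : phi 1%g = 1%g.
  by apply: (mulgI (phi 1%g)); rewrite -phiM !mulg1.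
by rewrite phiM chiM //; apply: phi_t.
Qed.

(** The [(k l)]-th power of [chi \o phi] is a monomial in two ways; both agree at all nonzero
    points, so the exponents coincide, and [k l] cancels over the rationals. *)
Lemma has_weight_uniq (G H : splitGroup) (phi : G -> H) M chi u u' :
    torus_nz G -> torus_onto G -> torus_morph phi M ->
  has_weight chi u -> has_weight (chi \o phi) u' -> u' = u *m ratmx M.
Proof.
move=> G_nz G_onto hM /has_weightP[_ [k [z [k0 hz ht]]]].
move=> /has_weightP[_ [l [y [l0 hy ht']]]].
have E : k%:Z *: y = l%:Z *: (z *m M).
  apply: (@monom_inj K) => s hs; have [t ts] := G_onto s hs.
  rewrite !monomZ -monom_mulmx // -(ht _ _ (hM _ _ ts)) -(ht' _ _ ts) /=.
  by rewrite -!exprnP -!exprM mulnC.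
have {}E : (u' *+ l) *+ k = (u *m ratmx M *+ k) *+ l.
  rewrite hy; have -> : u *m ratmx M *+ k = ratmx (z *m M).
    by rewrite ratmxM -hz -!scaler_nat scalemxAl.
  by apply/rowP => i; have /rowP/(_ i) := E; rewrite !mulmxnE !mxE
    => /(congr1 (intr : int -> rat)); rewrite !intrM !mulr_natl.
have kl : (k * l)%:R != 0 :> rat by rewrite pnatr_eq0 muln_eq0 !eqn0Ngt k0 l0.
apply: (scalerI kl); rewrite !scaler_nat.
by rewrite [in LHS]mulnC !mulrnA.
Qed.

(** Uniqueness of the image: each presentation of [Q] by weights leads to the same substitution. *)
Lemma S2_map_subst (G H : splitGroup) (phi : G -> H) M Q Q' :
    torus_nz G -> torus_onto G -> torus_morph phi M ->
  S2_map phi Q Q' -> Q' = subst_mx (ratmx M) Q.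
Proof.
move=> G_nz G_onto hM; elim=> [|P P' chi psi u v u' v' _ -> hu hv hu' hv'].
  by rewrite /subst_mx raddf0.
rewrite subst_mxD subst_mxM !subst_linear_form.
by rewrite (has_weight_uniq _ _ hM hu hu') // (has_weight_uniq _ _ hM hv hv').
Qed.

Definition weight_map (G H : splitGroup) (phi : G -> H) u u' :=
  exists2 chi : H -> K, has_weight chi u & has_weight (chi \o phi) u'.

(** The existence half: a presentation by weights that stay weights after composition with [phi] is
    all that [S2_map] asks for. *)
Lemma S2_map_span (G H : splitGroup) (phi : G -> H) M Q :
    quad_span (fun u => weight_map phi u (u *m M)) Q ->
  S2_map phi Q (subst_mx M Q).
Proof.
elim=> [|P u v _ IH [chi cu cu'] [psi pv pv']].
  by rewrite /subst_mx raddf0; constructor.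
by rewrite subst_mxD subst_mxM !subst_linear_form; apply: (S2_map_add IH cu pv).
Qed.

Section Closed.
Variable G : splitGroup.
Hypothesis reg_mul : forall f g : G -> K, regular f -> regular g ->
  regular (fun x => f x * g x).
Hypothesis G_nz : torus_nz G.

Lemma torus_charM (chi psi : G -> K) : torus_char chi -> torus_char psi ->
  torus_char (fun x => chi x * psi x).
Proof.
move=> [[f fr fE] c1 cM] [[g gr gE] p1 pM]; split=> [||t u ht hu].
- by exists (fun x => f x * g x) => [|t ht]; [exact: reg_mul | rewrite fE ?gE].
- by rewrite c1 p1 mulr1.
by rewrite cM // pM // mulrACA.
Qed.

Lemma has_weightM (chi psi : G -> K) u v : has_weight chi u -> has_weight psi v ->
  has_weight (fun x => chi x * psi x) (u + v).
Proof.
move=> /has_weightP[hc [k [z [k0 hz ht]]]] /has_weightP[hp [l [y [l0 hy hs]]]].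
apply/has_weightP; split; first exact: torus_charM.
exists (k * l)%N, (l%:Z *: z + k%:Z *: y); split.
- by rewrite muln_gt0 k0.
- rewrite mulrnDl mulrnA hz mulnC mulrnA hy; apply/rowP => i.
  by rewrite !(mulmxnE, mxE) intrD !intrM !mulr_natl.
move=> t s hts; rewrite monomD; last exact: G_nz hts.
rewrite !monomZ -!exprnP -(ht _ _ hts) -(hs _ _ hts) exprMn -!exprM.
by rewrite [(l * k)%N]mulnC.
Qed.
End Closed.

Lemma weight_mapD (G H : splitGroup) (phi : G -> H) u u' v v' :
    (forall f g : G -> K, regular f -> regular g -> regular (fun x => f x * g x)) ->
    (forall f g : H -> K, regular f -> regular g -> regular (fun x => f x * g x)) ->
    torus_nz G -> torus_nz H ->
  weight_map phi u u' -> weight_map phi v v' -> weight_map phi (u + v) (u' + v').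
Proof.
move=> rG rH G_nz H_nz [chi hu hu'] [psi hv hv'].
exists (fun x => chi x * psi x); first exact: has_weightM.
exact: (has_weightM rG G_nz hu' hv').
Qed.

Lemma S2_mapD (G H : splitGroup) (phi : G -> H) Q1 Q1' Q2 Q2' :
  S2_map phi Q1 Q1' -> S2_map phi Q2 Q2' -> S2_map phi (Q1 + Q2) (Q1' + Q2').
Proof.
move=> h1; elim=> [|P P' chi psi u v u' v' _ IH hu hv hu' hv']; first by rewrite !addr0.
by rewrite !addrA; apply: S2_map_add hv hu' hv'.
Qed.

Lemma S2_invariantMn (G : splitGroup) (Q : {mpoly rat[rank G]}) k :
  S2_invariant Q -> S2_invariant (Q *+ k).
Proof.
move=> h w /h{}h; elim: k => [|k IH]; first by rewrite mulr0n; constructor.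
by rewrite mulrS; apply: S2_mapD.
Qed.

Section Product.
Variables G1 G2 : splitGroup.
Let G := prodSG iota G1 G2.

Hypothesis one_torus1 : in_torus (1%g : G1).
Hypothesis one_torus2 : in_torus (1%g : G2).

Lemma in_torus_prod (t : G) : in_torus t <-> in_torus t.1 /\ in_torus t.2.
Proof.
split=> [[s [h1 h2]]|[[s1 h1] [s2 h2]]]; first by split; [exists (lsubmx s)|exists (rsubmx s)].
by exists (row_mx s1 s2); split; rewrite ?row_mxKl ?row_mxKr.
Qed.

Lemma has_weight_fst (chi : G1 -> K) u :
  has_weight chi u -> has_weight (chi \o fst : G -> K) (row_mx u 0).
Proof.
move=> /has_weightP[[[f fr fE] c1 cM] [k [z [k0 hz ht]]]].
apply/has_weightP; split.
  split=> [|//|t t' /in_torus_prod[h _] /in_torus_prod[h' _]]; last exact: cM.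
  exists (f \o fst) => [|t /in_torus_prod[/fE]//].
  by apply: subalg_gen; left; exists f.
exists k, (row_mx z 0); split=> //.
  by apply/rowP => i; rewrite mulmxnE !mxE; case: split => j;
     rewrite ?mxE ?mul0rn // -mulmxnE hz mxE.
move=> t s [h1 _]; rewrite /= (ht _ _ h1) /monom big_split_ord /=.
rewrite [X in _ * X]big1 => [|i _]; last by rewrite row_mxEr mxE expr0z.
by rewrite mulr1; apply: eq_bigr => i _; rewrite row_mxEl mxE.
Qed.

Lemma has_weight_snd (chi : G2 -> K) u :
  has_weight chi u -> has_weight (chi \o snd : G -> K) (row_mx 0 u).
Proof.
move=> /has_weightP[[[f fr fE] c1 cM] [k [z [k0 hz ht]]]].
apply/has_weightP; split.
  split=> [|//|t t' /in_torus_prod[_ h] /in_torus_prod[_ h']]; last exact: cM.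
  exists (f \o snd) => [|t /in_torus_prod[_ /fE]//].
  by apply: subalg_gen; right; exists f.
exists k, (row_mx 0 z); split=> //.
  by apply/rowP => i; rewrite mulmxnE !mxE; case: split => j;
     rewrite ?mxE ?mul0rn // -mulmxnE hz mxE.
move=> t s [_ h2]; rewrite /= (ht _ _ h2) /monom big_split_ord /=.
rewrite [X in X * _]big1 => [|i _]; last by rewrite row_mxEl mxE expr0z.
by rewrite mul1r; apply: eq_bigr => i _; rewrite row_mxEr mxE.
Qed.

(** Testing on [(t, 1)] and [(1, t)] shows that each component of a normalising pair normalises its
    own torus; presentations on the factors are then transported along the projections. *)
Lemma S2_invariant_pair (Q1 : {mpoly rat[rank G1]}) (Q2 : {mpoly rat[rank G2]}) :
  S2_invariant Q1 -> S2_invariant Q2 ->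
  @S2_invariant K G (S2_pair Q1 Q2).
Proof.
move=> h1 h2 [w1 w2] hw.
have n1 t : in_torus t <-> in_torus (t ^ w1)%g.
  have E : (((t, 1) : G) ^ (w1, w2) = (t ^ w1, 1 ^ w2) :> G)%g by [].
  by have := hw (t, 1%g); rewrite E !in_torus_prod /= conj1g; tauto.
have n2 t : in_torus t <-> in_torus (t ^ w2)%g.
  have E : (((1, t) : G) ^ (w1, w2) = (1 ^ w1, t ^ w2) :> G)%g by [].
  by have := hw (1%g, t); rewrite E !in_torus_prod /= conj1g; tauto.
apply: S2_mapD.
  have := h1 w1 n1; move: {1 2}Q1 {2 4}Q1 => Q Q'.
  elim=> [|P P' chi psi u v u' v' _ IH hu hv hu' hv'].
    by rewrite !raddf0; constructor.
  rewrite !raddfD /= !rmorphM /= !linear_form_l.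
  apply: S2_map_add IH (has_weight_fst hu) (has_weight_fst hv) _ _.
    exact: has_weight_fst hu'.
  exact: has_weight_fst hv'.
have := h2 w2 n2; move: {1 2}Q2 {2 4}Q2 => Q Q'.
elim=> [|P P' chi psi u v u' v' _ IH hu hv hu' hv'].
  by rewrite !raddf0; constructor.
rewrite !raddfD /= !rmorphM /= !linear_form_r.
apply: S2_map_add IH (has_weight_snd hu) (has_weight_snd hv) _ _.
  exact: has_weight_snd hu'.
exact: has_weight_snd hv'.
Qed.
End Product.
End Weights.

(** * Normalisers of diagonal tori; PSp and PSO *)

Lemma rev_lshift n (a : 'I_n) : rev_ord (lshift n a) = rshift n (rev_ord a).
Proof. by apply: val_inj => /=; have := ltn_ord a; lia. Qed.

Lemma rev_rshift n (a : 'I_n) : rev_ord (rshift n a) = lshift n (rev_ord a).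
Proof. by apply: val_inj => /=; have := ltn_ord a; lia. Qed.

(** The weights of the standard representation in the order of the basis:
    [e_1, .., e_r, -e_r, .., -e_1]. *)
Definition evec r (k : 'I_(r + r)) : 'rV[int]_r :=
  match split k with
  | inl a => delta_mx 0 a
  | inr a => - delta_mx 0 (rev_ord a)
  end.

Lemma evec_l r (a : 'I_r) : evec (lshift r a) = delta_mx 0 a.
Proof. by rewrite /evec (unsplitK (inl _ a)). Qed.
Lemma evec_r r (a : 'I_r) : evec (rshift r a) = - delta_mx 0 (rev_ord a).
Proof. by rewrite /evec (unsplitK (inr _ a)). Qed.

Lemma evec_rev r (k : 'I_(r + r)) : evec (rev_ord k) = - evec k.
Proof.
case: (split_ordP k) => a ->.
  by rewrite rev_lshift evec_r evec_l rev_ordK.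
by rewrite rev_rshift evec_r evec_l opprK.
Qed.

Definition abs_index r (k : 'I_(r + r)) : 'I_r :=
  match split k with inl a => a | inr a => rev_ord a end.

Lemma linear_form_evec r (k : 'I_(r + r)) :
  linear_form (ratmx (evec k)) ^+ 2 = 'X_(abs_index k) ^+ 2.
Proof.
rewrite /evec /abs_index; case: split => a.
  by rewrite ratmx_delta linear_form_delta.
by rewrite ratmxN ratmx_delta raddfN /= linear_form_delta sqrrN.
Qed.

Section Normalizer.
Variable K : closedFieldType.

Lemma diag_torusE r (s : 'rV[K]_r) (i j : 'I_(r + r)) :
  diag_torus s i j = monom s (evec i) *+ (i == j).
Proof.
rewrite /diag_torus mxE; congr (_ *+ _).
case: (split_ordP i) => a ->; rewrite ?row_mxEl ?row_mxEr ?evec_l ?evec_r.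
  by rewrite monom_delta.
by rewrite monomN monom_delta mxE.
Qed.

Lemma diag_torus_mull r (s : 'rV[K]_r) n (A : 'M_(_, n)) i j :
  (diag_torus s *m A) i j = monom s (evec i) * A i j.
Proof.
rewrite mxE (bigD1 i) //= big1 ?addr0 => [|k ki]; rewrite diag_torusE ?eqxx //.
by rewrite eq_sym (negbTE ki) mul0r.
Qed.

Lemma diag_torus_mulr r (s : 'rV[K]_r) n (A : 'M_(n, _)) i j :
  (A *m diag_torus s) i j = A i j * monom s (evec j).
Proof.
rewrite mxE (bigD1 j) //= big1 ?addr0 => [|k ki]; rewrite diag_torusE ?eqxx //.
by rewrite (negbTE ki) mulr0.
Qed.

Lemma monom_evecl r (s : 'rV[K]_r) i : monom s (evec (lshift r i)) = s 0 i.
Proof. by rewrite evec_l monom_delta. Qed.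

Lemma diag_torusN r (s : 'rV[K]_r) : diag_torus (- s) = - diag_torus s.
Proof.
by rewrite /diag_torus; apply/matrixP => i j; rewrite !mxE -mulNrn; congr (_ *+ _);
  case: split => a; rewrite !mxE ?invrN.
Qed.

Lemma diag_torusM r (s s' : 'rV[K]_r) :
  diag_torus s *m diag_torus s' = diag_torus (\row_i (s 0 i * s' 0 i)).
Proof.
apply/matrixP => i j; rewrite diag_torus_mull !diag_torusE mulrnAr; congr (_ *+ _).
case: (split_ordP i) => a ->; rewrite ?evec_l ?evec_r ?monomN !monom_delta !mxE //.
by rewrite invfM.
Qed.

Lemma diag_torus1 r : diag_torus (const_mx 1) = 1%:M :> 'M[K]_(r + r).
Proof.
apply/matrixP => i j; rewrite diag_torusE mxE; congr (_ *+ _).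
case: (split_ordP i) => a ->; rewrite ?evec_l ?evec_r ?monomN !monom_delta !mxE //.
by rewrite invr1.
Qed.

Lemma diag_torus_nz r (s : 'rV[K]_r) : diag_torus s \in unitmx -> nz s.
Proof.
move=> h i; apply/eqP => si; have /rowP/(_ (lshift r i)) := congr1 (row (lshift r i)) (mulmxV h).
rewrite !mxE big1 ?eqxx => [|k _]; first by move/esym/eqP; rewrite oner_eq0.
by rewrite diag_torusE monom_evecl si mul0rn mul0r.
Qed.

Lemma unitmx_col_neq0 n (A : 'M[K]_n) i : A \in unitmx -> exists j, A j i != 0.
Proof.
move=> uA; apply/existsP; apply: contraT; rewrite negb_exists => /forallP h.
have /matrixP/(_ i i) := mulVmx uA.
rewrite !mxE eqxx big1 => [/esym/eqP|k _]; first by rewrite oner_eq0.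
by move: (h k); rewrite negbK => /eqP->; rewrite mulr0.
Qed.

Lemma neq01 : exists x : K, (x != 0) && (x != 1).
Proof.
apply/not_existsP => h; have := @exprz_inj K 0 1.
suff E : forall x : K, x != 0 -> x ^ 0 = x ^ 1 by move=> /(_ E).
move=> x x0; rewrite expr0z; have := h x; rewrite x0 /=; case: eqP => [-> _|_ /(_ isT)//].
by rewrite exp1rz.
Qed.

(* A nonzero entry in column [i] of [B] reads off the image of the weight [e_i]. *)
Lemma torus_normalizer r (B : 'M[K]_(r + r)) : B \in unitmx ->
    (forall s', nz s' -> exists2 s, nz s & diag_torus s *m B = B *m diag_torus s') ->
  exists M : 'M[int]_r,
    [/\ forall s s', diag_torus s *m B = B *m diag_torus s' -> s' = monmap s M,
        forall i, exists k, evec i *m M = evec k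
      & subst_mx (ratmx M) (sum_sqr r) = sum_sqr r].
Proof.
move=> uB hB.
have [pi hpi] : exists pi : 'I_r -> 'I_(r + r), forall i, B (pi i) (lshift r i) != 0.
  by exists (fun i => xchoose (unitmx_col_neq0 (lshift r i) uB)) => i;
    exact: xchooseP (unitmx_col_neq0 _ uB).
have pi_mon s s' i : diag_torus s *m B = B *m diag_torus s' ->
    s' 0 i = monom s (evec (pi i)).
  move=> /matrixP/(_ (pi i) (lshift r i)).
  rewrite diag_torus_mull diag_torus_mulr monom_evecl [_ * B _ _]mulrC.
  by move/(mulfI (hpi i)).
(* Otherwise two coordinates of [s'] would be equal or inverse for every [s']; the point with [x] at
   [j] and 1 elsewhere, [x] different from 1, excludes this. *)
have abs_inj : injective (fun i => abs_index (pi i)).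
  move=> i j ij; apply/eqP; apply: contraT => nij.
  have [x /andP[x0 x1]] := neq01.
  pose s' : 'rV[K]_r := \row_k if k == j then x else 1.
  have s'_nz : nz s' by move=> k; rewrite mxE; case: ifP => _ //; apply: oner_neq0.
  have [s s_nz hs] := hB s' s'_nz.
  have := pi_mon _ _ i hs; have := pi_mon _ _ j hs.
  rewrite !mxE eqxx (negbTE nij) /evec; move: ij; rewrite /abs_index.
  case: split => a; case: split => b ->; rewrite ?monomN !monom_delta => Ex E1;
    case/eqP: x1; rewrite Ex -?E1 ?invr1 //.
  by apply: invr_inj; rewrite -E1 invr1.
exists (\matrix_i evec (pi i)); split.
- by move=> s s' E; apply/rowP => i; rewrite (pi_mon _ _ _ E) mxE rowK.
- move=> i; case: (split_ordP i) => a ->.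
    by exists (pi a); rewrite evec_l -rowE rowK.
  by exists (rev_ord (pi (rev_ord a))); rewrite evec_r mulNmx -rowE rowK evec_rev.
(* The rows of [M] are the [e_k] up to sign, each once, so the squares are merely permuted. *)
rewrite subst_sum_sqr [RHS](reindex_inj abs_inj) /=.
apply: eq_bigr => i _; rewrite -linear_form_evec; congr (linear_form _ ^+ 2).
by apply/rowP => j; rewrite !mxE.
Qed.

End Normalizer.

(** * Quotients of matrix groups by -1: characters and invariant forms *)

Section MatrixQuotient.
Variables (F : fieldType) (K : closedFieldType) (iota : {rmorphism F -> K}).
Variables (r : nat) (S : mxGroup K (r + r)).
Hypothesis S_diag : forall s : 'rV[K]_r, nz s -> S (diag_torus s).
Let G0 : algGroup K := mxAlgGroup iota S.
Variable z : central_inv G0.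
Hypothesis zN1 : mxval (cinv z) = - 1%:M.
Let G0T : splitGroup K := @SplitGroup _ G0 r (fun A s => mxval A = diag_torus s).
Let G : splitGroup K := quotSG (G := G0T) z.

Lemma quot_projE (A B : G0T) : quot2_proj z A = quot2_proj z B ->
  mxval B = mxval A \/ mxval B = - mxval A.
Proof.
move/quot2_projE => /orP[] /eqP ->; first by left.
by right; rewrite /= zN1 mulmxN mulmx1.
Qed.

Lemma quot_torus_nz : torus_nz G.
Proof.
move=> t s [g _ E]; apply: diag_torus_nz; rewrite -E; exact: mxelt_unit.
Qed.

Definition diag_elt s (hs : nz s) : G0T := MxElt (S_diag hs).

Lemma quot_torus_onto : torus_onto G.
Proof. by move=> s hs; exists (quot2_proj z (diag_elt hs)); exists (diag_elt hs). Qed.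

Lemma quot_one_torus : in_torus (1%g : G).
Proof. by exists (const_mx 1), 1%g => //=; rewrite diag_torus1. Qed.

(** The diagonal torus contains -1 and is closed under negation, so it is the full preimage of its
    image. *)
Lemma quot_in_torus (g : G0T) :
  in_torus (quot2_proj z g : G) -> exists s, mxval g = diag_torus s.
Proof.
move=> [s [g' /quot_projE E Es]]; case: E => E; rewrite Es in E; first by exists s.
by exists (- s); rewrite diag_torusN E opprK.
Qed.

(** The choice of representative does not matter: -1 changes the sign of both factors. *)
Definition root_char (i j : 'I_(r + r)) (x : G) : K :=
  mxval (repr x : G0T) i i * mxval (repr x : G0T) j j.

Lemma root_charE i j (g : G0T) :
  root_char i j (quot2_proj z g) = mxval g i i * mxval g j j.
Proof.
case: (quot_projE (quot2_repr (quot2_proj z g))) => E; rewrite /root_char E //.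
by rewrite !mxE mulrNN.
Qed.

Lemma root_char_torus i j t s : torus_coord (t : G) s ->
  root_char i j t = monom s (evec i + evec j).
Proof.
move=> ts; have s_nz := quot_torus_nz ts; case: ts => g -> E.
by rewrite root_charE E !diag_torusE !eqxx monomD.
Qed.

Lemma torus_coordM (t u : G) s s' : torus_coord t s -> torus_coord u s' ->
  torus_coord (t * u)%g (\row_i (s 0 i * s' 0 i)).
Proof.
move=> [g -> E] [h -> E']; exists (g * h)%g; first exact/esym/quot2_projM.
by rewrite /= E E' diag_torusM.
Qed.

Lemma root_weight i j :
  has_weight (G := G) (root_char i j) (ratmx (evec i + evec j)).
Proof.
apply/has_weightP; split; last first.
  by exists 1%N, (evec i + evec j); split=> // t s; rewrite expr1; exact: root_char_torus.
split=> [||t u [s ts] [s' us]].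
- exists (root_char i j) => //=.
  have -> : root_char i j \o @quot2_proj G0 z =
      fun g : G0 => mxval g i i * mxval g j j.
    by apply/funext => g; exact: root_charE.
  by apply: subalg_mul; apply: subalg_gen; do 2!eexists.
- by rewrite root_charE /= !mxE !eqxx mulr1.
have t_nz := quot_torus_nz ts; have u_nz := quot_torus_nz us.
rewrite (root_char_torus _ _ (torus_coordM ts us)).
rewrite (root_char_torus _ _ ts) (root_char_torus _ _ us).
rewrite /monom -big_split; apply: eq_bigr => k _ /=.
by rewrite mxE expfzMl.
Qed.

(** On the torus, conjugation turns [root_char i j] into [root_char i' j'], where [M] carries
    [evec i], [evec j] to [evec i'], [evec j']; this gives regularity over [F]. Both [e_i - e_m] and
    [2 e_m] are sums of two such vectors. *)
Lemma quot_invariant k c : k *+ r = (4 * c)%:R :> rat -> k \is a Num.nat ->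
  S2_invariant (G := G) (k *: sum_sqr r).
Proof.
move=> kr kn w; rewrite -(quot2_repr w); move: (repr w : G0T) => W {w} hw.
have uW : mxval W \in unitmx by exact: mxelt_unit.
have conjE s g : mxval (g : G0T) = diag_torus s ->
    forall s', mxval (g ^ W)%g = diag_torus s' ->
    diag_torus s *m mxval W = mxval W *m diag_torus s'.
  by move=> <- s' <-; rewrite /conjg /= !mulmxA mulmxV // mul1mx.
have projJ g : (quot2_proj z g ^ quot2_proj z W)%g = quot2_proj z (g ^ W)%g.
  by rewrite /conjg (quot2_projM z) quot2_projM quot2_projV.
have [M [hM hev hsq]] : exists M : 'M[int]_r,
    [/\ forall s s', diag_torus s *m mxval W = mxval W *m diag_torus s' -> s' = monmap s M,
        forall i, exists k, evec i *m M = evec k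
      & subst_mx (ratmx M) (sum_sqr r) = sum_sqr r].
  apply: torus_normalizer => // s' s'_nz.
  pose t := (diag_elt s'_nz ^ W^-1)%g.
  have : in_torus (quot2_proj z t : G).
    by apply/hw; rewrite projJ conjgKV; exists s', (diag_elt s'_nz).
  case/quot_in_torus => s Es; exists s.
    by apply: diag_torus_nz; rewrite -Es; exact: mxelt_unit.
  by apply: conjE Es _ _; rewrite conjgKV.
have Mt : torus_morph (G := G) (H := G) (fun t => t ^ quot2_proj z W)%g M.
  move=> t s ts; have : in_torus (t ^ quot2_proj z W)%g by apply: (hw t).1; exists s.
  case: ts => g -> Es; rewrite projJ => /quot_in_torus[s' Es'].
  exists (g ^ W)%g => //; apply: (etrans Es'); congr diag_torus.
  exact: hM (conjE _ _ Es _ Es').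
have W_root i j : weight_map (G := G) (H := G) (fun t => t ^ quot2_proj z W)%g
    (ratmx (evec i + evec j)) (ratmx (evec i + evec j) *m ratmx M).
  exists (root_char i j); first exact: root_weight.
  apply: (has_weight_comp _ Mt _ (root_weight i j)); first exact: quot_torus_nz.
  have [i' Ei] := hev i; have [j' Ej] := hev j.
  have E t : in_torus (t : G) -> root_char i j (t ^ quot2_proj z W)%g = root_char i' j' t.
    move=> [s ts]; have s_nz := quot_torus_nz ts.
    rewrite (root_char_torus _ _ (Mt _ _ ts)) (root_char_torus _ _ ts).
    by rewrite monom_mulmx // mulmxDl Ei Ej.
  have [[[f fr fE] c1 cM] _] := root_weight i' j'.
  split=> [||t u ht hu] /=.
  - by exists f => // t ht; rewrite E // fE.
  - by rewrite E ?c1 //; exact: quot_one_torus.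
  have htu : in_torus (t * u)%g.
    by case: ht hu => s ts [s' us]; exists (\row_i (s 0 i * s' 0 i)); exact: torus_coordM.
  by rewrite !E // cM.
(* The target copy of the form is written as its own substitution by [M]. *)
rewrite -{2}hsq -subst_mxZ; apply: S2_map_span.
(* [quad_span_root] needs a reference index [m]; in rank 0 the form vanishes. *)
have [m _|r0] := pickP (fun _ : 'I_r => true); last first.
  rewrite /sum_sqr big1 => [|i]; last by have := r0 i.
  by rewrite scaler0; constructor.
have E a : ratmx (evec (lshift r a)) = delta_mx 0 a.
  by rewrite evec_l ratmx_delta.
apply: (quad_span_root (m := m)) kr kn => [i|].
  have := W_root (lshift r i) (rev_ord (lshift r m)).
  by rewrite evec_rev ratmxD ratmxN !E.
by have := W_root (lshift r m) (lshift r m); rewrite ratmxD E mulr2n.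
Qed.
End MatrixQuotient.

(** * The spinor torus and HSpin *)

(* Whether [e_k] occurs in the [i]-th basis element [e_I] of the exterior algebra,
   with the block decomposition of [clifford_rec]. *)
Fixpoint spin_bit N : 'I_(spin_dim N) -> nat -> bool :=
  match N with
  | 0%N => fun _ _ => false
  | N'.+1 => fun i k =>
      match split i with
      | inl j => if k is k'.+1 then @spin_bit N' j k' else false
      | inr j => if k is k'.+1 then @spin_bit N' j k' else true
      end
  end.

Lemma spin_bit_ex N (b : nat -> bool) :
  exists i : 'I_(spin_dim N), forall k, (k < N)%N -> spin_bit i k = b k.
Proof.
elim: N b => [|N IH] b; first by exists ord0.
have [i hi] := IH (fun k => b k.+1).
exists (if b 0%N then rshift _ i else lshift _ i) => -[_|k hk] /=.
  by case: (b 0%N); rewrite ?(unsplitK (inl _ i)) ?(unsplitK (inr _ i)).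
by case: (b 0%N); rewrite ?(unsplitK (inl _ i)) ?(unsplitK (inr _ i)) hi.
Qed.

(** Twice the weight of [e_I] in the spin representation, which makes it integral. *)
Definition spin_vec N (i : 'I_(spin_dim N)) : 'rV[int]_N :=
  \row_k (if spin_bit i k then 1 else -1).

Lemma spin_dim_gt0 N : (0 < spin_dim N)%N.
Proof. by elim: N => //= N IH; rewrite addn_gt0 IH. Qed.

Section SpinTorus.
Variable K : closedFieldType.

(* The spinor lift of [diag_torus s], up to a scalar: it acts on [e_I] by the
   product of the [s_k] with [k] in [I]. *)
Fixpoint delta N : 'rV[K]_N -> 'M[K]_(spin_dim N) :=
  match N with
  | 0%N => fun _ => 1%:M
  | N'.+1 => fun s =>
      let d := delta (\row_k s 0 (lift ord0 k)) in block_mx d 0 0 (s 0 ord0 *: d)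
  end.

Lemma deltaE N (s : 'rV[K]_N) i j :
  delta s i j = (\prod_(k < N) if spin_bit i k then s 0 k else 1) *+ (i == j).
Proof.
elim: N s i j => [|N IH] s i j /=; first by rewrite big_ord0 mxE.
rewrite big_ord_recl.
case: (split_ordP i) => a ->; case: (split_ordP j) => b ->;
  rewrite ?block_mxEul ?block_mxEur ?block_mxEdl ?block_mxEdr ?mxE.
- rewrite (inj_eq (@lshift_inj _ _)) IH mul1r; congr (_ *+ _).
  by apply: eq_bigr => k _; rewrite mxE.
- by rewrite eq_lrshift mulr0n.
- by rewrite eq_rlshift mulr0n.
rewrite (inj_eq (@rshift_inj _ _)) IH mulrnAr; congr (_ * _ *+ _).
by apply: eq_bigr => k _; rewrite mxE.
Qed.

Lemma deltaM N (s s' : 'rV[K]_N) :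
  delta s *m delta s' = delta (\row_k (s 0 k * s' 0 k)).
Proof.
elim: N s s' => [|N IH] s s' /=; first by rewrite mulmx1.
rewrite mulmx_block !mul0mx !mulmx0 !addr0 add0r -scalemxAl -scalemxAr scalerA.
rewrite IH mxE.
by have -> : \row_k ((\row_j s 0 (lift ord0 j)) 0 k * (\row_j s' 0 (lift ord0 j)) 0 k) =
  \row_k (\row_j (s 0 j * s' 0 j)) 0 (lift ord0 k) by apply/rowP => k; rewrite !mxE.
Qed.

Lemma delta1 N : delta (const_mx 1 : 'rV_N) = 1%:M.
Proof.
apply/matrixP => i j; rewrite deltaE mxE big1 // => k _.
by rewrite mxE; case: ifP.
Qed.

Lemma delta_unit N (s : 'rV[K]_N) : nz s -> delta s \in unitmx.
Proof.
move=> hs; have : delta s *m delta (\row_k (s 0 k)^-1) = 1%:M.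
  rewrite deltaM -delta1; congr delta; apply/rowP => k.
  by rewrite !mxE divff.
by case/mulmx1_unit.
Qed.

(** Each [s_k] occurs on half of the basis elements; the square makes the exponent [spin_dim N]
    itself. *)
Lemma det_delta N (s : 'rV[K]_N) : \det (delta s) ^+ 2 = (\prod_k s 0 k) ^+ spin_dim N.
Proof.
elim: N s => [|N IH] s /=; first by rewrite det1 big_ord0 !expr1n.
rewrite det_ublock detZ big_ord_recl.
have := IH (\row_k s 0 (lift ord0 k)).
under eq_bigr do rewrite mxE.
move: (\prod_(i < N) _) (\det _) => p d E.
have -> : (d * (s 0 ord0 ^+ spin_dim N * d)) ^+ 2 =
  s 0 ord0 ^+ spin_dim N * s 0 ord0 ^+ spin_dim N * (d ^+ 2) * (d ^+ 2) by ring.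
by rewrite E exprMn !exprD; ring.
Qed.

Lemma delta_clifford_rec N (s : 'rV[K]_N) x y : nz s ->
  delta s *m clifford_rec x y =
  clifford_rec (\col_k (s 0 k * x k 0)) (\col_k ((s 0 k)^-1 * y k 0)) *m delta s.
Proof.
elim: N s x y => [|N IH] s x y hs /=; first by rewrite mulmx0 mul0mx.
rewrite !mulmx_block !mul0mx !mulmx0 !addr0 !add0r.
rewrite IH => [|k]; last by rewrite mxE.
have E (z : 'cV_N.+1) (t : 'rV_N.+1) :
    \col_k ((\row_j t 0 (lift ord0 j)) 0 k * (\col_j z (lift ord0 j) 0) k 0) =
    \col_k (\col_j (t 0 j * z j 0)) (lift ord0 k) 0.
  by apply/colP => k; rewrite !mxE.
have E' : \col_k (((\row_j s 0 (lift ord0 j)) 0 k)^-1 * (\col_j y (lift ord0 j) 0) k 0) =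
    \col_k (\col_j ((s 0 j)^-1 * y j 0)) (lift ord0 k) 0.
  by apply/colP => k; rewrite !mxE.
rewrite E E' !mul_mx_scalar !mul_scalar_mx !mxE; congr block_mx.
- by rewrite scalerA mulrAC mulVf ?mul1r.
- by rewrite scalerA mulrC.
by rewrite mulmxN mulNmx -scalemxAl -scalemxAr IH ?E ?E' // => k; rewrite mxE.
Qed.

Lemma clifford_rec0 N : clifford_rec (0 : 'cV[K]_N) 0 = 0.
Proof.
have := clifford_rec_lin (-1) (0 : 'cV[K]_N) 0 0 0.
by rewrite scaler0 addr0 scaleN1r addNr.
Qed.

(** Schur's lemma for spinors: commuting with the wedge and the contraction by the first basis
    vector forces the blocks to be [A, 0, 0, A], and [A] commutes with the smaller Clifford
    algebra. *)
Lemma clifford_centralizer N (X : 'M[K]_(spin_dim N)) :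
  (forall x y, X *m clifford_rec x y = clifford_rec x y *m X) -> exists c, X = c%:M.
Proof.
elim: N X => [|N IH] X hX; first by exists (X 0 0); exact: mx11_scalar.
rewrite -(submxK X) in hX *.
move: (ulsubmx X) (ursubmx X) (dlsubmx X) (drsubmx X) hX => A B C D hX.
pose e : 'cV[K]_N.+1 := delta_mx ord0 0.
have h1 := hX e 0; have h2 := hX 0 e; move: h1 h2 => /=.
have E0 : \col_k (0 : 'cV[K]_N.+1) (lift ord0 k) 0 = 0 by apply/colP => k; rewrite !mxE.
have Ee : \col_k e (lift ord0 k) 0 = 0 by apply/colP => k; rewrite !mxE.
rewrite E0 Ee clifford_rec0 oppr0 !mxE eqxx /= !mulmx_block !mulmx0 !mul0mx !mulmx1 !mul1mx.
have S0 n : 0%:M = 0 :> 'M[K]_n by exact: raddf0.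
rewrite !S0 !mulmx0 !mul0mx !addr0 !add0r.
case/eq_block_mx => EB _ EDA _; case/eq_block_mx => EC _ _ _.
have [|c Ec] := IH A.
  move=> x y; pose ext (z : 'cV[K]_N) : 'cV[K]_N.+1 := \col_k oapp (fun j => z j 0) 0 (unlift ord0 k).
  have Ex z : \col_k ext z (lift ord0 k) 0 = z by apply/colP => k; rewrite !mxE liftK.
  have := hX (ext x) (ext y) => /=; rewrite !Ex !mulmx_block => /eq_block_mx[].
  by rewrite !mxE unlift_none /= !S0 !mulmx0 !mul0mx !addr0.
by exists c; rewrite [RHS]scalar_mx_block -Ec EDA EB EC.
Qed.

Lemma delta_cover N (s : 'rV[K]_N) v : nz s ->
  delta s *m clifford v = clifford (diag_torus s *m v) *m delta s.
Proof.
move=> hs; rewrite /clifford delta_clifford_rec //; congr (clifford_rec _ _ *m _).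
  by apply/colP => k; rewrite [RHS]mxE diag_torus_mull monom_evecl !mxE.
apply/colP => k; rewrite [RHS]mxE diag_torus_mull evec_rev evec_l.
by rewrite monomN monom_delta !mxE.
Qed.

Lemma clifford_surj N (x y : 'cV[K]_N) : exists v : 'cV_(N + N), clifford v = clifford_rec x y.
Proof.
exists (col_mx x (\col_k y (rev_ord k) 0)); rewrite /clifford; congr clifford_rec.
  by apply/colP => k; rewrite mxE col_mxEu.
apply/colP => k; rewrite mxE.
by rewrite rev_lshift col_mxEd mxE rev_ordK.
Qed.

(** If [w = u - v] acts by zero, its anticommutators vanish, hence so does [bform w]; pairing with
    [t *: eps + eps'] for [t = 0] and [t = 1] kills both coordinates of [w] belonging to an
    index. *)
Lemma clifford_inj N : injective (@clifford K N).
Proof.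
move=> u v E; apply/eqP; rewrite -subr_eq0; apply/eqP.
have {}E : clifford (u - v) = 0.
  by rewrite addrC -scaleN1r clifford_lin E scaleN1r addNr.
have hb w : bform (u - v) w = 0.
  have := clifford_anticomm (u - v) w.
  rewrite E mul0mx mulmx0 subr0 => /esym/matrixP.
  move/(_ (Ordinal (spin_dim_gt0 N)) (Ordinal (spin_dim_gt0 N))).
  by rewrite !mxE eqxx.
move: (u - v) hb => w hw; apply/colP => k; rewrite mxE.
have bf (a : 'I_N) (z : 'cV[K]_(N + N)) : bform w z = bform z w.
  by apply: eq_bigr => j _; rewrite addrC mulrC [X in _ + X]mulrC.
have E1 a t : t * w (rev_ord (lshift N a)) 0 + w (lshift N a) 0 = 0.
  by rewrite -(bform_eps t w (erefl a.+1)) -bf.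
have wl a : w (lshift N a) 0 = 0 by rewrite -(E1 a 0) mul0r add0r.
have wr a : w (rev_ord (lshift N a)) 0 = 0 by rewrite -(E1 a 1) mul1r wl addr0.
case: (split_ordP k) => a ->; first exact: wl.
by rewrite -[rshift N a]rev_ordK rev_rshift wr.
Qed.

(** [X] and [delta s] move vectors alike, so their quotient centralises the Clifford algebra. *)
Lemma scalar_of_cover N (s : 'rV[K]_N) (X : 'M_(spin_dim N)) : nz s ->
    (forall v, X *m clifford v = clifford (diag_torus s *m v) *m X) ->
  exists c, X = c *: delta s.
Proof.
move=> hs hX; have us := delta_unit hs.
have [|c Ec] := @clifford_centralizer N (invmx (delta s) *m X).
  move=> x y; have [v <-] := clifford_surj x y.
  apply: (can_inj (mulKmx us)); rewrite !mulmxA mulmxV // mul1mx hX.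
  by rewrite delta_cover // mulmxK.
by exists c; rewrite -[X](mulKVmx us) Ec mul_mx_scalar.
Qed.

End SpinTorus.

(** * Spinor norms and the cover of SO by Spin *)

Section SpinCover.
Variable K : closedFieldType.

Lemma toral_rec N a (t : K) : (a < N)%N ->
  clifford_rec (\col_(j < N) (t * (j == a :> nat)%:R)) (\col_(j < N) (j == a :> nat)%:R) *m
  clifford_rec (\col_(j < N) (j == a :> nat)%:R) (\col_(j < N) (j == a :> nat)%:R) =
  delta (\row_(j < N) if j == a :> nat then t else 1).
Proof.
elim: N a => [//|N IH] [_|a aN] /=.
  have E u : \col_k (\col_(j < N.+1) (u * (j == 0 :> nat)%:R)) (lift ord0 k) 0 = 0 :> 'cV[K]_N.
    by apply/colP => k; rewrite !mxE mulr0.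
  have E1 : \col_k (\col_(j < N.+1) (j == 0 :> nat)%:R) (lift ord0 k) 0 = 0 :> 'cV[K]_N.
    by apply/colP => k; rewrite !mxE.
  have -> : \row_k (\row_(j < N.+1) if j == 0 :> nat then t else 1) 0 (lift ord0 k) = const_mx 1.
    by apply/rowP => k; rewrite !mxE.
  rewrite E E1 clifford_rec0 oppr0 delta1 !mxE /= mulr1 mulmx_block !mulmx0 !mul0mx !addr0 !add0r.
  by rewrite !mulmx1 scale_scalar_mx mulr1.
have E u : \col_k (\col_(j < N.+1) (u * (j == a.+1 :> nat)%:R)) (lift ord0 k) 0 =
    \col_(j < N) (u * (j == a :> nat)%:R) :> 'cV[K]_N.
  by apply/colP => k; rewrite !mxE.
have E1 : \col_k (\col_(j < N.+1) (j == a.+1 :> nat)%:R) (lift ord0 k) 0 =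
    \col_(j < N) (j == a :> nat)%:R :> 'cV[K]_N.
  by apply/colP => k; rewrite !mxE.
have S0 n : 0%:M = 0 :> 'M[K]_n by exact: raddf0.
have -> : \row_k (\row_(j < N.+1) if j == a.+1 :> nat then t else 1) 0 (lift ord0 k) =
    \row_(j < N) if j == a :> nat then t else 1.
  by apply/rowP => k; rewrite !mxE.
rewrite E E1 !mxE /= mulr0 S0 mulmx_block !mulmx0 !mul0mx !addr0 !add0r.
by rewrite mulmxN mulNmx opprK scale1r IH.
Qed.

Lemma toral_delta N k (t : K) : (0 < k <= N)%N ->
  toral N k t = delta (\row_(j < N) if j.+1 == k then t else 1).
Proof.
case: k => [//|k] /= kN; have := toral_rec t kN.
rewrite /toral /clifford => <-.
have E u : \col_(i < N) (u *: eps K N k.+1 + eps' K N k.+1) (lshift N i) 0 =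
    \col_i (u * (i == k :> nat)%:R).
  apply/colP => i; rewrite !mxE /= eqSS.
  have -> : ((i + k.+1)%N == (N + N)%N) = false by have := ltn_ord i; lia.
  by rewrite addr0.
have E' u : \col_(i < N) (u *: eps K N k.+1 + eps' K N k.+1) (rev_ord (lshift N i)) 0 =
    \col_i (i == k :> nat)%:R.
  apply/colP => i; rewrite !mxE /=; have hi := ltn_ord i.
  have -> : ((N + N - i.+1).+1 == k.+1) = false by lia.
  by rewrite mulr0 add0r; congr (nat_of_bool _)%:R; lia.
rewrite -[in X in _ *m clifford_rec X _](scale1r (eps K N k.+1)).
rewrite -[in X in _ *m clifford_rec _ X](scale1r (eps K N k.+1)).
rewrite !E !E'; congr (_ *m clifford_rec _ _).
by apply/colP => i; rewrite !mxE mul1r.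
Qed.

Lemma xi1_delta r : exists s, nz s /\ xi1_mx K (2 * r) = delta s.
Proof.
rewrite /xi1_mx big_seq_cond.
elim/big_ind: _ => [|_ _ [s [hs ->]] [s' [hs' ->]]|k].
- exists (const_mx 1); rewrite delta1; split=> // i; rewrite mxE; exact: oner_neq0.
- by exists (\row_i (s 0 i * s' 0 i)); rewrite deltaM; split=> // i; rewrite mxE mulf_neq0.
rewrite mem_index_iota => /andP[kr _]; rewrite /h_alpha !toral_delta; try by lia.
rewrite deltaM; eexists; split; last by [].
by move=> i; rewrite !mxE invrN1; do 2!case: ifP => _; rewrite ?mulf_neq0 ?oppr_eq0 ?oner_neq0.
Qed.

(** Both sides act on vectors by -1, hence are proportional. The entry at the empty set [I], where
    every [delta] is 1, fixes the scalar; [xi1_delta] is what makes it readable for [xi1]. *)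
Lemma xi1E r : xi1_mx K (2 * r) = delta (const_mx (-1)).
Proof.
have [s [_ Es]] := xi1_delta r.
have [||c Ec] := @scalar_of_cover K (2 * r) (const_mx (-1)) (xi1_mx K (2 * r)).
- by move=> i; rewrite mxE oppr_eq0 oner_neq0.
- move=> v; rewrite xi1_anticomm.
  have -> : const_mx (-1) = - const_mx 1 :> 'rV[K]_(2 * r).
    by apply/rowP => i; rewrite !mxE.
  by rewrite diag_torusN diag_torus1 mulNmx mul1mx -[in RHS]scaleN1r cliffordZ scaleN1r mulNmx.
have [i hi] := spin_bit_ex (2 * r) xpred0.
have D (t : 'rV[K]_(2 * r)) : delta t i i = 1.
  by rewrite deltaE eqxx big1 // => k _; rewrite hi.
have /matrixP/(_ i i) := Ec; rewrite {1}Es mxE !D mulr1 => c1.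
by rewrite Ec -c1 scale1r.
Qed.

(** An even Clifford product of spinor norm [c]; [Spin_pred] is the case [c = 1]. *)
Definition even_cliff N (g : 'M[K]_(spin_dim N)) (c : K) :=
  exists s : seq 'cV[K]_(N + N),
    [/\ ~~ odd (size s), \prod_(v <- s) qform v = c & g = cliff_prod s].

Lemma even_cliffM N (g h : 'M[K]_(spin_dim N)) c d :
  even_cliff g c -> even_cliff h d -> even_cliff (g *m h) (c * d).
Proof.
move=> [s [hs ns ->]] [t [ht nt ->]].
exists (s ++ t); rewrite size_cat oddD (negbTE hs) (negbTE ht).
by rewrite big_cat /= ns nt cliff_prod_cat.
Qed.

Lemma qformZ N a (v : 'cV[K]_(N + N)) : qform (a *: v) = a ^+ 2 * qform v.
Proof. by rewrite /qform mulr_sumr; apply: eq_bigr => k _; rewrite !mxE; ring. Qed.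

Lemma even_cliffZ N a : (0 < N)%N -> even_cliff (a%:M : 'M[K]_(spin_dim N)) (a ^+ 2).
Proof.
move=> N0; pose u := eps K N 1 + eps' K N 1.
have qu : qform u = 1 by rewrite /u -[eps K N 1]scale1r qform_eps // N0.
exists [:: a *: u; u]; split=> //.
  by rewrite !big_cons big_nil qformZ qu !mulr1.
rewrite /cliff_prod !big_cons big_nil mulmx1 cliffordZ -scalemxAl clifford_sqr qu.
by rewrite scale_scalar_mx mulr1.
Qed.

Lemma even_cliff_toral N k t : (0 < k <= N)%N -> even_cliff (toral N k t : 'M[K]_(spin_dim N)) t.
Proof.
move=> kN; exists [:: t *: eps K N k + eps' K N k; eps K N k + eps' K N k]; split=> //.
  rewrite !big_cons big_nil -[eps K N k in X in _ * X]scale1r !qform_eps //.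
  by rewrite !mulr1.
by rewrite /cliff_prod !big_cons big_nil mulmx1.
Qed.

Lemma even_cliff_delta N (s : 'rV[K]_N) : even_cliff (delta s) (\prod_k s 0 k).
Proof.
suff h j : (j <= N)%N ->
    even_cliff (delta (\row_(k < N) if (k < j)%N then s 0 k else 1))
               (\prod_(k < N) if (k < j)%N then s 0 k else 1).
  have := h N (leqnn N); congr (even_cliff (delta _) _).
    by apply/rowP => k; rewrite mxE ltn_ord.
  by apply: eq_bigr => k _; rewrite ltn_ord.
elim: j => [_|j IH jN].
  exists [::]; rewrite /cliff_prod !big_nil; split=> //; last first.
    by rewrite -delta1; congr delta; apply/rowP => k; rewrite !mxE.
  by rewrite big1.
have := even_cliffM (IH (ltnW jN)) (even_cliff_toral (s 0 (Ordinal jN)) (_ : 0 < j.+1 <= N)%N).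
move=> /(_ jN); rewrite toral_delta // deltaM; congr (even_cliff (delta _) _).
  apply/rowP => k; rewrite !mxE eqSS ltnS; case: ltngtP => [_|_|kj]; rewrite ?mulr1 ?mul1r //.
  by congr (s 0 _); apply: val_inj.
rewrite [RHS](bigD1 (Ordinal jN)) //= ltnSn mulrC; congr (_ * _).
rewrite (bigD1 (Ordinal jN)) //= ltnn mul1r; apply: eq_bigr => k kj.
have -> // : (k < j.+1)%N = (k < j)%N.
by move: kj; rewrite -val_eqE /=; lia.
Qed.

Lemma spin_lift N (s : 'rV[K]_N) : (0 < N)%N -> nz s ->
  exists g : mxelt (Spin_mx K N), spin_cover g (diag_torus s).
Proof.
move=> N0 hs; have p0 : \prod_k s 0 k != 0 by apply/prodf_neq0 => k _.
(* A square root [a] of the inverse of [prod_k s_k]: scaling by [a] multiplies the spinor norm by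
   [a^2], bringing it to 1. *)
have [a ha] := @solve_monicpoly K 2
  (fun i => if i == 0%N then (\prod_k s 0 k)^-1 else 0) isT.
rewrite !big_ord_recl big_ord0 /= mulr1 mul0r !addr0 in ha.
have hg : Spin_pred (a%:M *m delta s).
  apply/asboolP; have := even_cliffM (even_cliffZ a N0) (even_cliff_delta s).
  by rewrite ha mulVf.
exists (@MxElt K _ (Spin_mx K N) _ hg) => v /=.
by rewrite mul_scalar_mx -scalemxAl delta_cover // -scalemxAr.
Qed.

(** [clifford v] squares to the scalar [qform v], so its squared determinant is a power of
    [qform v], and the norms multiply to 1. *)
Lemma spin_det N (g : mxelt (Spin_mx K N)) : \det (mxval g) ^+ 2 = 1.
Proof.
case: g => g /= /asboolP[s [_ hs ->]].
have -> : 1 = (\prod_(v <- s) qform v) ^+ spin_dim N by rewrite hs expr1n.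
elim: s {hs} => [|v s IH]; rewrite /cliff_prod ?big_nil ?big_cons.
  by rewrite det1 !expr1n.
rewrite det_mulmx !exprMn -IH; congr (_ * _).
by rewrite expr2 -det_mulmx clifford_sqr det_scalar.
Qed.

Lemma spin_coverM N (g h : mxelt (Spin_mx K N)) A B :
  spin_cover g A -> spin_cover h B -> spin_cover (g * h)%g (A *m B).
Proof.
by move=> hA hB v; rewrite /= -mulmxA hB mulmxA hA -!mulmxA.
Qed.

Lemma spin_cover_uniq N (g : mxelt (Spin_mx K N)) A B :
  spin_cover g A -> spin_cover g B -> A = B.
Proof.
move=> hA hB; apply/matrixP => i j.
have E : A *m delta_mx j (0 : 'I_1) = B *m delta_mx j 0.
  apply: clifford_inj; apply: (can_inj (mulmxK (mxelt_unit g))).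
  by rewrite -hA hB.
by have /colP/(_ i) := E; rewrite -!colE !mxE.
Qed.

(** Conjugation by [clifford u] is minus the reflection in [u], that is
    [v |-> (bform u v / qform u) u - v]; the row [b] represents [bform u]. *)
Lemma spin_cover_ex N (g : mxelt (Spin_mx K N)) : exists A, spin_cover g A.
Proof.
rewrite /spin_cover; case: g => g /= /asboolP[s [_ hs ->]].
have : \prod_(v <- s) qform v != 0 by rewrite hs oner_neq0.
elim: s {hs} => [|u s IH]; rewrite /cliff_prod ?big_nil ?big_cons.
  by exists 1%:M => v; rewrite mul1mx mul1mx mulmx1.
rewrite mulf_eq0 negb_or => /andP[u0 /IH[A hA]].
pose b : 'rV[K]_(N + N) := \row_k u (rev_ord k) 0.
have hb v : b *m v = (bform u v)%:M.
  rewrite [LHS]mx11_scalar; congr (_%:M); rewrite mxE big_split_ord /=.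
  rewrite [X in _ + X](reindex_inj rev_ord_inj) -big_split; apply: eq_bigr => k _ /=.
  by rewrite -rev_lshift !mxE rev_ordK addrC.
exists (((qform u)^-1 *: (u *m b) - 1%:M) *m A) => v.
rewrite -!mulmxA hA !mulmxA; congr (_ *m _).
rewrite -!mulmxA; move: (A *m v) => {}v.
rewrite mulmxBl mul1mx -scalemxAl -mulmxA hb mul_mx_scalar clifford_anticomm.
have -> : (qform u)^-1 *: (bform u v *: u) - v = (bform u v / qform u) *: u + -1 *: v.
  by rewrite scalerA mulrC scaleN1r.
rewrite clifford_lin cliffordZ mulmxDl -!scalemxAl clifford_sqr.
by rewrite scale_scalar_mx mulfVK // scaleN1r.
Qed.

Lemma spin_cover_unit N (g : mxelt (Spin_mx K N)) A : spin_cover g A -> A \in unitmx.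
Proof.
move=> hA; have [B hB] := spin_cover_ex (g^-1)%g.
have := spin_coverM hA hB; rewrite mulgV => h.
have : A *m B = 1%:M.
  by apply: spin_cover_uniq h _ => v; rewrite /= !mul1mx mulmx1.
by case/mulmx1_unit.
Qed.

(** The relation between [c] and [s] is [spin_det] evaluated by [det_delta]. *)
Lemma spin_torus N (g : mxelt (Spin_mx K N)) s : spin_cover g (diag_torus s) ->
  nz s /\ exists c, mxval g = c *: delta s /\
          c ^+ (spin_dim N * 2) * (\prod_k s 0 k) ^+ spin_dim N = 1.
Proof.
move=> hg; have hs : nz s by apply: diag_torus_nz; exact: spin_cover_unit hg.
split=> //; have [c Ec] := scalar_of_cover hs hg; exists c; split=> //.
by have := spin_det g; rewrite Ec detZ exprMn det_delta -exprM.
Qed.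

End SpinCover.

Lemma quad_span_sub r (W W' : 'rV[rat]_r -> Prop) Q :
  (forall u, W u -> W' u) -> quad_span W Q -> quad_span W' Q.
Proof. by move=> h; elim=> [|P u v _ IH /h hu /h hv]; constructor. Qed.

Definition half_vec N (i : 'I_(spin_dim N)) : 'rV[rat]_N := 2^-1 *: ratmx (spin_vec i).

(** * Half-spin weights and the invariant form of HSpin *)

Section HalfSpin.
Variables (F : fieldType) (K : closedFieldType) (iota : {rmorphism F -> K}).
Variable r : nat.
Local Notation N := (2 * r)%N.
Local Notation G := (HSpin iota r).
Local Notation S := (Spin iota N).
Let xi : S := xi1 iota r.

(** [xi1] acts on [e_I] by [(-1)^|I|]; the entries selected here belong to the half-spin
    representation on which it is trivial. *)
Definition spin_even (i : 'I_(spin_dim N)) := xi1_mx K N i i == 1.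

Lemma spin_evenE i :
  spin_even i = (\prod_(k < N) (if spin_bit i k then -1 else 1 : K) == 1).
Proof.
rewrite /spin_even xi1E deltaE eqxx mulr1n; congr (_ == _).
by apply: eq_bigr => k _; rewrite mxE.
Qed.

(** Only closure under addition is asked of [W], since regular functions are closed under products.
    Negatives come for free: the opposite of a half-spin weight belongs to the complement of [I], of
    the same parity because [N] is even. *)
Lemma hspin_span (W : 'rV[rat]_N -> Prop) : (0 < r)%N -> (2 %| r)%N ->
    (forall u v, W u -> W v -> W (u + v)) ->
    (forall i, spin_even i -> W (half_vec i)) ->
  quad_span W (q_HSpin r).
Proof.
move=> r0 r2 WD Wh.
have vecE b : exists i : 'I_(spin_dim N),
    (spin_even i = (\prod_(k < N) (if b (k : nat) then -1 else 1 : K) == 1)) /\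
    half_vec i = \row_(k < N) if b k then 2^-1 else - 2^-1.
  have [i hi] := spin_bit_ex N b; exists i; split.
    by rewrite spin_evenE; congr (_ == _); apply: eq_bigr => k _; rewrite hi.
  by apply/rowP => k; rewrite !mxE hi //; case: ifP; rewrite ?mulr1 ?mulrN1.
pose W2 u := W u /\ W (- u).
apply: (@quad_span_sub _ W2) => [u []//|].
have W2D u v : W2 u -> W2 v -> W2 (u + v).
  by move=> [u1 u2] [v1 v2]; split; rewrite ?opprD; apply: WD.
have W2N u : W2 u -> W2 (- u) by move=> []; rewrite /W2 opprK.
have W2h (b : nat -> bool) : \prod_(k < N) (if b k then -1 else 1 : K) = 1 ->
    W2 (\row_(k < N) if b k then 2^-1 else - 2^-1).
  move=> hb; split.
    by have [i [ei <-]] := vecE b; apply: Wh; rewrite ei hb.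
  have [i [ei]] := vecE (fun k => ~~ b k).
  have -> : \row_(k < N) (if ~~ b k then 2^-1 else - 2^-1) =
      - \row_(k < N) (if b k then 2^-1 else - 2^-1) :> 'rV[rat]_N.
    by apply/rowP => k; rewrite !mxE; case: (b k); rewrite //= opprK.
  move=> <-; apply: Wh; rewrite ei -[X in X == _]mulr1 -[in X in _ * X]hb -big_split /=.
  rewrite (eq_bigr (fun=> -1)) => [|k _]; last by case: (b k); rewrite /= ?mulr1 ?mul1r.
  by rewrite prodr_const cardT size_enum_ord exprM sqrrN !expr1n.
pose e (a : 'I_N) : 'rV[rat]_N := delta_mx 0 a.
(* The weight of [I = {a, b}] minus the weight of the empty set. *)
have W2e a b : a != b -> W2 (e a + e b).
  move=> ab; have := W2h (fun k => (k == a) || (k == b)).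
  rewrite (bigD1 a) //= (bigD1 b) 1?eq_sym //= !eqxx orbT big1 => [|k /andP[ka kb]]; last first.
    by rewrite -!val_eqE in ka kb; rewrite (negbTE ka) (negbTE kb).
  rewrite mulr1 mulrN1 opprK => /(_ erefl) h1.
  have := W2h xpred0; rewrite big1 // => /(_ erefl) /W2N h0.
  have -> : e a + e b = (\row_(k < N) if (k == a :> nat) || (k == b :> nat)
      then 2^-1 else - 2^-1) - \row_(k < N) (- 2^-1); last exact: W2D.
  apply/rowP => k; rewrite !mxE !eqxx /= !val_eqE.
  case: eqP => [->|_]; last by case: eqP.
  by rewrite (negbTE ab).
have N4 : (4 <= N)%N by case: (r) r0 r2 => [//|[//|k]] _ _; lia.
have m_lt : (0 < N)%N by lia.
pose m := Ordinal m_lt.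
(* An auxiliary index, available since [N >= 4]: it produces [e_a - e_m] and [2 e_m] from sums of
   two distinct basis vectors. *)
have ex a : exists2 b, b != a & b != m.
  have h1 : (1 < N)%N by lia.
  have h2 : (2 < N)%N by lia.
  have [a1|a1] := eqVneq (Ordinal h1) a.
    by exists (Ordinal h2) => //; rewrite -a1.
  by exists (Ordinal h1).
have W2d a : W2 (e a - e m).
  have [b ba bm] := ex a.
  have -> : e a - e m = (e a + e b) - (e b + e m) by rewrite opprD addrA addrK.
  by apply: W2D; [apply: W2e; rewrite eq_sym | apply/W2N/W2e].
have W2m : W2 (e m *+ 2).
  have [b _ bm] := ex m.
  have -> : e m *+ 2 = (e b + e m) - (e b - e m) by rewrite mulr2n opprB addrC addrA subrK.
  by apply: W2D; [apply: W2e | apply/W2N/W2d].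
have W2o : W2 (const_mx 2^-1).
  have := W2h xpredT; rewrite prodr_const cardT size_enum_ord exprM sqrrN !expr1n.
  by move/(_ erefl); congr W2; apply/rowP => k; rewrite !mxE.
(* Here [lambda r = l / 2], [N = 4 q] with [q = r / 2], and [c] is half of [l q]. *)
rewrite /q_HSpin /lambda r2; case: ifP => r4.
  apply: (quad_span_spin (l := 1) (q := (r %/ 2)%N) (c := (r %/ 4)%N) W2d W2m W2D W2N W2o).
  - by rewrite mul1r.
  - by lia.
  by lia.
apply: (quad_span_spin (l := 2) (q := (r %/ 2)%N) (c := (r %/ 2)%N) W2d W2m W2D W2N W2o).
- by rewrite divff.
- by lia.
by lia.
Qed.

Lemma xi_cover : spin_cover xi (diag_torus (const_mx (-1))).
Proof.
move=> v; rewrite [mxval xi]xi1E delta_cover // => i.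
by rewrite mxE oppr_eq0 oner_neq0.
Qed.

Lemma hspin_projE (g h : S) : to_HSpin g = to_HSpin h -> h = g \/ h = (g * xi)%g.
Proof. by move/quot2_projE => /orP[] /eqP ->; [left|right]. Qed.

Lemma hspin_in_torus (g : S) :
  in_torus (to_HSpin g : G) -> exists s, spin_cover g (diag_torus s).
Proof.
move=> [s [g' /hspin_projE E hs]]; case: E => E; first by exists s; rewrite -E.
exists (\row_i (s 0 i * (const_mx (-1) : 'rV[K]_N) 0 i)); rewrite -diag_torusM.
have -> : g = (g' * xi)%g by rewrite E -mulgA xi1M mulg1.
exact: spin_coverM hs xi_cover.
Qed.

Lemma hspin_torus_nz : torus_nz G.
Proof. by move=> t s [g _ /spin_torus[]]. Qed.

Lemma hspin_regM (f g : G -> K) : regular f -> regular g ->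
  regular (fun x => f x * g x).
Proof. exact: subalg_mul. Qed.

Definition spin_char i (x : G) : K := mxval (repr x : S) i i.

(** [xi1] is diagonal with entry 1 at [i], so [g] and [g * xi] have the same entry there. *)
Lemma spin_charE i (g : S) : spin_even i -> spin_char i (to_HSpin g) = mxval g i i.
Proof.
move=> /eqP ei; case: (hspin_projE (esym (quot2_repr (to_HSpin g)))) => E; rewrite /spin_char E //.
have -> : mxval (g * xi)%g = mxval g *m xi1_mx K N by [].
rewrite xi1E mxE (bigD1 i) //= big1 => [|j ji].
  by rewrite -xi1E ei mulr1 addr0.
by rewrite deltaE (negbTE ji) mulr0.
Qed.

Lemma spin_diag (g : S) s i j : spin_cover g (diag_torus s) ->
  mxval g i j = mxval g i i *+ (i == j).
Proof.
move=> /spin_torus[_ [c [-> _]]]; rewrite !mxE !deltaE eqxx.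
by rewrite mulrnAr.
Qed.

Lemma spin_entry_mull (g : S) s (A : 'M_(spin_dim N)) i j : spin_cover g (diag_torus s) ->
  (mxval g *m A) i j = mxval g i i * A i j.
Proof.
move=> hg; rewrite mxE (bigD1 i) //= big1 ?addr0 // => k ki.
by rewrite (spin_diag _ _ hg) eq_sym (negbTE ki) mul0r.
Qed.

Lemma spin_entry_mulr (g : S) s (A : 'M_(spin_dim N)) i j : spin_cover g (diag_torus s) ->
  (A *m mxval g) i j = A i j * mxval g j j.
Proof.
move=> hg; rewrite mxE (bigD1 j) //= big1 ?addr0 // => k kj.
by rewrite (spin_diag _ _ hg) (negbTE kj) mulr0.
Qed.

Lemma monom_spin_vec (s : 'rV[K]_N) i : nz s ->
  monom s (spin_vec i) * \prod_k s 0 k = (\prod_(k < N) if spin_bit i k then s 0 k else 1) ^+ 2.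
Proof.
move=> hs; rewrite -big_split -prodrXl; apply: eq_bigr => k _ /=.
rewrite mxE; case: ifP => _; first by rewrite expr1z expr2.
by rewrite expr1n exprN1 mulVf.
Qed.

(* An element of the spinor torus is [c delta(s)] with [c^2 prod_k s_k = 1]. Only the
   power of this equation provided by [spin_torus] is used: weights are defined up to
   passing to a multiple. *)
Lemma spin_weight i : spin_even i -> has_weight (G := G) (spin_char i) (half_vec i).
Proof.
move=> ei; apply/has_weightP; split.
  split=> [||_ _ [s [g -> hg]] [s' [h -> hh]]].
  - exists (spin_char i) => //=.
    have -> : spin_char i \o @to_HSpin _ _ iota r = fun g : S => mxval g i i.
      by apply/funext => g; exact: spin_charE.
    by apply: subalg_gen; do 2!eexists.
  - by rewrite spin_charE //= mxE eqxx.
  have -> : (to_HSpin g * to_HSpin h)%g = to_HSpin (g * h)%g :> G.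
    exact/esym/quot2_projM.
  by rewrite !spin_charE //= (spin_entry_mull _ _ _ hg).
exists (spin_dim N * 2)%N, ((spin_dim N)%:Z *: spin_vec i); split.
- by rewrite muln_gt0 spin_dim_gt0.
- rewrite /half_vec; apply/rowP => k.
  rewrite mulmxnE !mxE intrM; move: (_%:~R : rat) (spin_dim _) => x d.
  by rewrite -[_ *+ _]mulr_natl natrM; field.
move=> _ s [g -> /spin_torus[hs [c [Eg Ec]]]].
rewrite spin_charE // Eg mxE deltaE eqxx mulr1n monomZ -exprnP exprMn.
have := monom_spin_vec i hs; move: Ec.
move: (\prod_k _) (\prod_(k < _) (if _ then _ else _)) (monom _ _) => q p m.
move: (spin_dim N) => d Ec Em.
by rewrite [in X in _ * X]mulnC [in X in _ * X]exprM -Em exprMn mulrCA Ec mulr1.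
Qed.

(** The signed permutation [M] alone would not do: an odd number of sign changes exchanges the two
    half-spin representations. The matrix of [w0] itself, which commutes with [xi1], shows that
    parity is kept. *)
Lemma hspin_invariant : (0 < r)%N -> (2 %| r)%N -> S2_invariant (G := G) (q_HSpin r).
Proof.
move=> r0 r2 w; rewrite -(quot2_repr w); move: (repr w : S) => w0 {w} hw.
have projJ g : (to_HSpin g ^ to_HSpin w0)%g = to_HSpin (g ^ w0)%g :> G.
  by apply/esym; rewrite /conjg /to_HSpin (quot2_projM (CentralInv _ _)) quot2_projM
             quot2_projV.
have [B hB] := spin_cover_ex w0.
have uB := spin_cover_unit hB.
have wg (g : S) : (w0 * (g ^ w0) = g * w0)%g by rewrite /conjg !mulgA mulgV mul1g.
have conjE (g : S) s s' : spin_cover g (diag_torus s) ->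
    spin_cover (g ^ w0)%g (diag_torus s') -> diag_torus s *m B = B *m diag_torus s'.
  move=> hg hg'; apply: spin_cover_uniq (spin_coverM hg hB) _.
  by rewrite -wg; exact: spin_coverM.
have [M [hM _ hsq]] : exists M : 'M[int]_N,
    [/\ forall s s', diag_torus s *m B = B *m diag_torus s' -> s' = monmap s M,
        forall i, exists k, evec i *m M = evec k
      & subst_mx (ratmx M) (sum_sqr N) = sum_sqr N].
  apply: torus_normalizer => // s' s'_nz.
  have [|g hg] := @spin_lift K N s' _ s'_nz; first by lia.
  have : in_torus (to_HSpin (g ^ w0^-1)%g : G).
    by apply/hw; rewrite projJ conjgKV; exists s', g.
  case/hspin_in_torus => s hs; exists s; first by have [] := spin_torus hs.
  by apply: conjE hs _; rewrite conjgKV.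
have Mt : torus_morph (G := G) (H := G) (fun t => t ^ to_HSpin w0)%g M.
  move=> t s ts; have : in_torus (t ^ to_HSpin w0)%g by apply: (hw t).1; exists s.
  case: ts => g -> hg; rewrite projJ => /hspin_in_torus[s' hs'].
  by exists (g ^ w0)%g => //; rewrite -(hM _ _ (conjE _ _ _ hg hs')).
rewrite {2}/q_HSpin -hsq -subst_mxZ; apply: S2_map_span.
apply: hspin_span => // [u v|i ei].
  rewrite mulmxDl; exact: (weight_mapD hspin_regM hspin_regM hspin_torus_nz hspin_torus_nz).
exists (spin_char i); first exact: spin_weight.
apply: (has_weight_comp hspin_torus_nz Mt _ (spin_weight ei)).
have [j hj] := unitmx_col_neq0 i (mxelt_unit w0).
have ent (g : S) s s' : spin_cover g (diag_torus s) -> spin_cover (g ^ w0)%g (diag_torus s') ->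
    mxval (g ^ w0)%g i i = mxval g j j.
  move=> hg hg'; apply: (mulfI hj); rewrite -(spin_entry_mulr _ _ _ hg').
  rewrite [RHS]mulrC -(spin_entry_mull _ _ _ hg).
  by have /(congr1 (fun x : S => mxval x j i)) := wg g.
(* [xi] is fixed by conjugation, so comparing its entries at [i] and [j] transfers evenness. *)
have ej : spin_even j.
  have Ex : (xi ^ w0 = xi)%g by apply: (mulgI w0); rewrite wg; exact/esym/xi1C.
  have := @ent xi _ _ xi_cover; rewrite Ex => /(_ _ xi_cover) E.
  by rewrite /spin_even -[xi1_mx K N]/(mxval xi) -E.
have E t : in_torus (t : G) -> spin_char i (t ^ to_HSpin w0)%g = spin_char j t.
  move=> [s ts]; have : in_torus (t ^ to_HSpin w0)%g by apply: (hw t).1; exists s.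
  case: ts => g -> hg; rewrite projJ => /hspin_in_torus[s' hs'].
  by rewrite !spin_charE // (ent _ _ _ hg hs').
have [[[f fr fE] c1 cM] _] := spin_weight ej.
have one_t : in_torus (1%g : G).
  exists (const_mx 1), (1%g : S) => // v.
  by rewrite diag_torus1 /= !mul1mx mulmx1.
split=> [||t u ht hu] /=.
- by exists f => // t ht; rewrite E // fE.
- by rewrite E ?c1.
have htu : in_torus (t * u)%g.
  case: ht hu => s [g -> hg] [s' [h -> hh]]; exists (\row_i (s 0 i * s' 0 i)), (g * h)%g.
    exact/esym/quot2_projM.
  by have := spin_coverM hg hh; rewrite diag_torusM.
by rewrite !E // cM.
Qed.

End HalfSpin.

(** * Kronecker products *)

Section Tensor.
Variable K : closedFieldType.

Lemma monom_row_mx r1 r2 (s : 'rV[K]_(r1 + r2)) z z' :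
  monom s (row_mx z z') = monom (lsubmx s) z * monom (rsubmx s) z'.
Proof.
rewrite /monom big_split_ord /=; congr (_ * _); apply: eq_bigr => i _.
  by rewrite row_mxEl mxE.
by rewrite row_mxEr mxE.
Qed.

(** [M] is supported on the antidiagonal, where the weights of row and column are opposite. *)
Lemma diag_torus_isometry r (s : 'rV[K]_r) (M : 'M_(r + r)) : nz s ->
    (forall i j, M i j != 0 -> j = rev_ord i) ->
  diag_torus s *m M *m (diag_torus s)^T = M.
Proof.
move=> hs hM; rewrite /diag_torus tr_diag_mx -/(diag_torus s).
apply/matrixP => i j; rewrite diag_torus_mulr diag_torus_mull.
have [->|/hM ->] := eqVneq (M i j) 0; first by rewrite mulr0 mul0r.
by rewrite evec_rev monomN mulrAC divff ?mul1r // monom_neq0.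
Qed.

Lemma Omega_neq0 r i j : Omega K r i j != 0 -> j = rev_ord i.
Proof.
rewrite mxE; case: (_ =P r.-1) => [h _|_]; last by rewrite eqxx.
by apply: val_inj => /=; have := ltn_ord i; have := ltn_ord j; lia.
Qed.

Lemma Psi_neq0 r i j : Psi K r i j != 0 -> j = rev_ord i.
Proof.
rewrite /Psi; case: (split_ordP i) => a ->; case: (split_ordP j) => b ->;
  rewrite ?block_mxEul ?block_mxEur ?block_mxEdl ?block_mxEdr ?[X in - X]mxE.
- by rewrite mxE eqxx.
- by move/Omega_neq0 => ->; rewrite rev_lshift.
- by rewrite mxE oppr_eq0 => /Omega_neq0 ->; rewrite rev_rshift.
by rewrite mxE eqxx.
Qed.

Lemma det_diag_torus r (s : 'rV[K]_r) : nz s -> \det (diag_torus s) = 1.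
Proof.
move=> hs; rewrite det_diag big_split_ord /= [X in _ * X](reindex_inj rev_ord_inj) /=.
rewrite -big_split big1 // => i _ /=.
by rewrite row_mxEl row_mxEr mxE rev_ordK divff.
Qed.

Lemma diag_torus_SO r (s : 'rV[K]_r) : nz s -> SO_mx K r (diag_torus s).
Proof.
move=> hs; apply/SO_predP; split; last exact: det_diag_torus.
by apply: diag_torus_isometry => // i j /Omega_neq0.
Qed.

Lemma diag_torus_Sp r (s : 'rV[K]_r) : nz s -> Sp_mx K r (diag_torus s).
Proof.
by move=> hs; apply/Sp_predP/diag_torus_isometry => // i j /Psi_neq0.
Qed.

Section Kron.
Variables n m : nat.
Local Notation N := (2 * (n * m))%N.

(** Reversing an index below [a * d] reverses both its quotient and its remainder by [d]. *)
Lemma sub_divmod q p d a X : (q < a)%N -> (p < d)%N -> (a * d = X)%N ->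
  (X - (q * d + p).+1 = (a - q.+1) * d + (d - p.+1))%N.
Proof.
move=> qa pd <-; have -> : a = (q.+1 + (a - q.+1))%N by lia.
by move: (a - q.+1)%N => c; rewrite addKn mulnDl mulSn; lia.
Qed.

Definition kron_index (k : 'I_(N + N)) : 'I_(n + n) * 'I_(m + m) :=
  mxtens_unindex (cast_ord (esym (kron_dim n m)) k).

Lemma kron_index_inj : injective kron_index.
Proof. by move=> k l /(can_inj (@mxtens_unindexK _ _))/cast_ord_inj. Qed.

Lemma kronE (A : 'M[K]_(n + n)) (B : 'M_(m + m)) k l :
  kron A B k l = A (kron_index k).1 (kron_index l).1 * B (kron_index k).2 (kron_index l).2.
Proof. by rewrite castmxE mxE. Qed.

Lemma kronM (A A' : 'M[K]_(n + n)) (B B' : 'M_(m + m)) :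
  kron A B *m kron A' B' = kron (A *m A') (B *m B').
Proof.
by rewrite /kron -tensmx_mul; move: (kron_dim n m) (_ *t _) (_ *t _) => e; case: _ / e.
Qed.

Lemma kron_index_rev k :
  kron_index (rev_ord k) = (rev_ord (kron_index k).1, rev_ord (kron_index k).2).
Proof.
have hk := ltn_ord k; have hd := kron_dim n m.
have m0 : (0 < m + m)%N by lia.
have E : ((N + N - k.+1) = (n + n - (k %/ (m + m)).+1) * (m + m) + (m + m - (k %% (m + m)).+1))%N.
  have h1 := ltn_pmod k m0; have h2 : (k %/ (m + m) < n + n)%N by rewrite ltn_divLR // hd.
  by rewrite {1}(divn_eq k (m + m)); apply: sub_divmod.
have hp : (m + m - (k %% (m + m)).+1 < m + m)%N by move: (_ %% _)%N => x; lia.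
congr (_, _); apply: val_inj; rewrite /= E.
  by rewrite divnMDl // (divn_small hp) addn0.
by rewrite modnMDl (modn_small hp).
Qed.

Fact kron_half_dim : N = (n * (m + m))%N.
Proof. by lia. Qed.

Definition half_index (k : 'I_N) : 'I_n * 'I_(m + m) :=
  mxtens_unindex (cast_ord kron_half_dim k).

Lemma half_index_bij : bijective half_index.
Proof.
exists (fun ij => cast_ord (esym kron_half_dim) (mxtens_index ij)) => k.
  by rewrite /half_index mxtens_unindexK cast_ordK.
by rewrite /half_index cast_ordKV mxtens_indexK.
Qed.

Lemma kron_index_l (k : 'I_N) :
  kron_index (lshift N k) = (lshift n (half_index k).1, (half_index k).2).
Proof. by congr (_, _); apply: val_inj. Qed.

(* The weights of [(A, B) |-> A (x) B], where [eta] lists the weights of [B] in the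
   rows of [A] indexed by [e_1 .. e_n]. *)
Definition tensor_mx (eta : 'I_(m + m) -> 'rV[int]_m) : 'M[int]_(N, n + m) :=
  \matrix_k row_mx (delta_mx 0 (half_index k).1) (eta (half_index k).2).

(** Position [rev_ord k] carries the opposite of the weight at [k], so in the rows of weight [-e_i]
    the list [eta] is read backwards and negated. *)
Definition tensor_eta (eta : 'I_(m + m) -> 'rV[int]_m) (i : 'I_(n + n)) j :=
  if split i is inl _ then eta j else - eta (rev_ord j).

Lemma tensor_monom eta (s : 'rV[K]_(n + m)) k : nz s ->
  monom (monmap s (tensor_mx eta)) (evec k) =
  monom (lsubmx s) (evec (kron_index k).1) *
  monom (rsubmx s) (tensor_eta eta (kron_index k).1 (kron_index k).2).
Proof.
move=> hs; have E a : monom (monmap s (tensor_mx eta)) (delta_mx 0 a) =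
   s 0 (lshift m (half_index a).1) * monom (rsubmx s) (eta (half_index a).2).
  by rewrite monom_delta mxE rowK monom_row_mx monom_delta mxE.
case: (split_ordP k) => a ->.
  by rewrite evec_l E kron_index_l /= evec_l monom_delta mxE /tensor_eta (unsplitK (inl _ _)).
rewrite evec_r monomN E.
rewrite -[rshift N a]rev_ordK rev_rshift.
rewrite kron_index_rev kron_index_l /= evec_rev evec_l monomN monom_delta mxE.
rewrite invfM; congr (_ * _); rewrite /tensor_eta.
by rewrite rev_lshift (unsplitK (inr _ _)) rev_ordK monomN.
Qed.

Lemma evec_tensor_eta i j : tensor_eta (@evec m) i j = evec j.
Proof. by rewrite /tensor_eta; case: split => // _; rewrite evec_rev opprK. Qed.

Lemma kron_diag_torus (s : 'rV[K]_(n + m)) : nz s ->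
  kron (diag_torus (lsubmx s)) (diag_torus (rsubmx s)) =
  diag_torus (monmap s (tensor_mx (@evec m))).
Proof.
move=> hs; apply/matrixP => k l; rewrite kronE !diag_torusE tensor_monom //.
rewrite evec_tensor_eta mulrnAl mulrnAr -mulrnA mulnb; congr (_ *+ nat_of_bool _).
by rewrite andbC -(inj_eq kron_index_inj); case: kron_index => *; case: kron_index.
Qed.

(** The order [f_1, .., f_m, -f_1, .., -f_m]: the block [-Omega] of [J] reverses the second half of
    the weights of [B]. *)
Definition sp_eta (j : 'I_(m + m)) : 'rV[int]_m :=
  match split j with inl a => delta_mx 0 a | inr a => - delta_mx 0 a end.

Lemma J_mx_neq0 i j : J_mx K m i j != 0 -> evec i = sp_eta j.
Proof.
rewrite /J_mx /sp_eta; case: (split_ordP i) => a ->; case: (split_ordP j) => b ->;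
  rewrite ?block_mxEul ?block_mxEur ?block_mxEdl ?block_mxEdr
          ?(unsplitK (inl _ _)) ?(unsplitK (inr _ _)).
- by rewrite mxE evec_l; case: (a =P b) => [->|_]; rewrite ?eqxx.
- by rewrite mxE eqxx.
- by rewrite mxE eqxx.
by rewrite mxE oppr_eq0 evec_r => /Omega_neq0 ->.
Qed.

Lemma K_mx_neq0 i j : K_mx K m i j != 0 -> evec i = - sp_eta (rev_ord j).
Proof.
rewrite /K_mx /sp_eta; case: (split_ordP i) => a ->; case: (split_ordP j) => b ->;
  rewrite ?block_mxEul ?block_mxEur ?block_mxEdl ?block_mxEdr
          ?rev_lshift ?rev_rshift ?(unsplitK (inl _ _)) ?(unsplitK (inr _ _)).
- by rewrite evec_l opprK => /Omega_neq0 ->; rewrite rev_ordK.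
- by rewrite mxE eqxx.
- by rewrite mxE eqxx.
by rewrite mxE evec_r; case: (a =P b) => [->|_]; rewrite ?eqxx.
Qed.

(** The two diagonal matrices scale rows and columns of [P], and nonzero entries of [J] and [K] join
    equal weights only. *)
Lemma P_mx_diag_torus (s : 'rV[K]_(n + m)) : nz s ->
  kron (diag_torus (lsubmx s)) (diag_torus (rsubmx s)) *m P_mx K n m =
  P_mx K n m *m diag_torus (monmap s (tensor_mx sp_eta)).
Proof.
move=> hs; rewrite kron_diag_torus //; apply/matrixP => k l.
rewrite diag_torus_mull diag_torus_mulr !tensor_monom // evec_tensor_eta.
rewrite [P_mx _ _ _ _ _]mxE !kronE.
move: (kron_index k) (kron_index l) => [k1 k2] [l1 l2] /=.
rewrite [RHS]mulrC; have := @K_mx_neq0 k2 l2; have := @J_mx_neq0 k2 l2.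
move: (J_mx K m k2 l2) (K_mx K m k2 l2) => x y hx hy.
case: (split_ordP k1) => a ->; case: (split_ordP l1) => b ->;
  rewrite ?block_mxEul ?block_mxEur ?block_mxEdl ?block_mxEdr !mxE !mul0r ?addr0 ?add0r ?mulr0 //.
- case: (a =P b) => [->|_]; last by rewrite mul0r !mulr0.
  rewrite mul1r; have [->|/hx ->] := eqVneq x 0; first by rewrite !mulr0.
  by rewrite /tensor_eta (unsplitK (inl _ _)).
case: (a =P b) => [->|_]; last by rewrite mul0r !mulr0.
rewrite mul1r; have [->|/hy ->] := eqVneq y 0; first by rewrite !mulr0.
by rewrite /tensor_eta (unsplitK (inr _ _)).
Qed.

Lemma P_mx_sqr : P_mx K n m *m P_mx K n m = 1%:M.
Proof.
have S0 p : 0%:M = 0 :> 'M[K]_p by exact: raddf0.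
have J2 : J_mx K m *m J_mx K m = 1%:M.
  rewrite mulmx_block !mul0mx !mulmx0 !addr0 !add0r mulmxN mulNmx opprK mul1mx Omega_sqr.
  by rewrite -scalar_mx_block.
have K2 : K_mx K m *m K_mx K m = 1%:M.
  rewrite mulmx_block !mul0mx !mulmx0 !addr0 !add0r mul1mx Omega_sqr.
  by rewrite -scalar_mx_block.
rewrite mulmxDl !mulmxDr !kronM J2 K2 !mulmx_block !mul0mx !mulmx0 !mul1mx !addr0 !add0r.
apply/matrixP => k l.
rewrite 3![in LHS]mxE !kronE [RHS]mxE -(inj_eq kron_index_inj).
move: (kron_index k) (kron_index l) => [k1 k2] [l1 l2] /=.
rewrite xpair_eqE -mulnb natrM.
case: (split_ordP k1) => a ->; case: (split_ordP l1) => b ->;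
  rewrite ?block_mxEul ?block_mxEur ?block_mxEdl ?block_mxEdr !mxE !mul0r ?addr0 ?add0r.
- by rewrite (inj_eq (@lshift_inj _ _)).
- by rewrite eq_lrshift mul0r.
- by rewrite eq_rlshift mul0r.
by rewrite (inj_eq (@rshift_inj _ _)).
Qed.

Lemma rho_Sp_diag_torus (s : 'rV[K]_(n + m)) : nz s ->
  invmx (P_mx K n m) *m kron (diag_torus (lsubmx s)) (diag_torus (rsubmx s)) *m P_mx K n m =
  diag_torus (monmap s (tensor_mx sp_eta)).
Proof.
by move=> hs; rewrite -mulmxA P_mx_diag_torus // mulKmx //; case/mulmx1_unit: P_mx_sqr.
Qed.

Lemma subst_tensor_mx eta :
    \sum_j eta j = 0 ->
    \sum_j linear_form (ratmx (eta j)) ^+ 2 = sum_sqr m *+ 2 ->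
  subst_mx (ratmx (tensor_mx eta)) (sum_sqr N) =
  S2_pair (sum_sqr n *+ (2 * m)) (sum_sqr m *+ (2 * n)).
Proof.
move=> eta0 eta2; rewrite subst_sum_sqr.
pose x i : {mpoly rat[n + m]} := 'X_(lshift m i).
pose y j := linear_form (ratmx (eta j)) \mPo [tuple 'X_(rshift n i) | i < m].
have y0 : \sum_j y j = 0.
  rewrite /y -raddf_sum -(raddf_sum (@linear_form m)) /= -ratmx_sum eta0 ratmx0.
  by rewrite !raddf0.
have y2 : \sum_j y j ^+ 2 = (sum_sqr m \mPo [tuple 'X_(rshift n i) | i < m]) *+ 2.
  by rewrite -raddfMn -eta2 raddf_sum; apply: eq_bigr => j _ /=; rewrite rmorphXn.
have x2 : sum_sqr n \mPo [tuple 'X_(lshift m i) | i < n] = \sum_i x i ^+ 2.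
  rewrite raddf_sum; apply: eq_bigr => i _ /=.
  by rewrite rmorphXn /= comp_mpolyXU -tnth_nth tnth_mktuple.
have E (f : 'I_n * 'I_(m + m) -> {mpoly rat[n + m]}) :
    \sum_k f (half_index k) = \sum_i \sum_j f (i, j).
  rewrite pair_big [RHS](reindex half_index) /=; last exact/onW_bij/half_index_bij.
  exact: eq_bigr.
transitivity (\sum_i \sum_j (x i + y j) ^+ 2).
  rewrite -(E (fun ij => (x ij.1 + y ij.2) ^+ 2)); apply: eq_bigr => k _; congr (_ ^+ 2).
  have -> : row k (ratmx (tensor_mx eta)) =
      row_mx (delta_mx 0 (half_index k).1) 0 + row_mx 0 (ratmx (eta (half_index k).2)).
    rewrite add_row_mx addr0 add0r -ratmx_delta; apply/rowP => i.
    by rewrite !mxE; case: split => j; rewrite [RHS]mxE.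
  rewrite raddfD /= -linear_form_l -linear_form_r linear_form_delta.
  by rewrite comp_mpolyXU -tnth_nth tnth_mktuple.
transitivity (\sum_i (x i ^+ 2 *+ (2 * m) +
  (sum_sqr m \mPo [tuple 'X_(rshift n i) | i < m]) *+ 2)).
  apply: eq_bigr => i _; rewrite -y2.
  under eq_bigr do rewrite sqrrD.
  rewrite !big_split /= sumr_const cardT size_enum_ord [(2 * m)%N]mul2n -addnn.
  by rewrite -mulr_sumr y0 mulr0 !addr0.
rewrite big_split /= sumr_const cardT size_enum_ord sumrMnl /S2_pair !raddfMn /= x2.
by rewrite -mulrnA.
Qed.

Lemma evec_sum0 : \sum_j @evec m j = 0.
Proof.
rewrite big_split_ord /= [X in _ + X](reindex_inj rev_ord_inj) -big_split big1 // => i _ /=.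
by rewrite evec_l evec_r rev_ordK subrr.
Qed.

Lemma evec_sum_sqr : \sum_j linear_form (ratmx (@evec m j)) ^+ 2 = sum_sqr m *+ 2.
Proof.
rewrite big_split_ord /= [X in _ + X](reindex_inj rev_ord_inj) -big_split -sumrMnl.
apply: eq_bigr => i _ /=.
by rewrite evec_l evec_r rev_ordK ratmxN ratmx_delta raddfN /= linear_form_delta sqrrN mulr2n.
Qed.

Lemma sp_eta_sum0 : \sum_j sp_eta j = 0.
Proof.
rewrite big_split_ord /= -big_split big1 // => i _ /=.
by rewrite /sp_eta (unsplitK (inl _ _)) (unsplitK (inr _ _)) subrr.
Qed.

Lemma sp_eta_sum_sqr : \sum_j linear_form (ratmx (sp_eta j)) ^+ 2 = sum_sqr m *+ 2.
Proof.
rewrite big_split_ord /= -big_split -sumrMnl.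
apply: eq_bigr => i _ /=.
rewrite /sp_eta (unsplitK (inl _ _)) (unsplitK (inr _ _)).
by rewrite ratmxN ratmx_delta raddfN /= linear_form_delta sqrrN mulr2n.
Qed.

End Kron.
End Tensor.

(** * Rost multipliers *)

(** With [n = 4 p + i] and [m = 4 q + j], the constants depend on [i] and [j] only, and each
    admissible pair leaves a polynomial identity in [p] and [q]. *)
Lemma rost_table_coef n m : (2 %| n)%N || (2 %| m)%N ->
  [/\ kappa n *+ (rost_table n m).1 = lambda (n * m) *+ (2 * m)
    & kappa m *+ (rost_table n m).2 = lambda (n * m) *+ (2 * n)].
Proof.
move=> nm2.
have d2 x : (2 %| x)%N = ~~ odd (x %% 4) by rewrite dvdn2; congr (~~ _); lia.
have d4 x y : (4 %| x * y)%N = (((x %% 4) * (y %% 4)) %% 4 == 0)%N.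
  by rewrite /dvdn modnMm.
rewrite /kappa /lambda /rost_table.
rewrite d4 Euclid_dvdM // !d2 ?/(4 %| _)%N.
rewrite !d2 in nm2.
have := divn_eq n 4; have := divn_eq m 4.
have := ltn_pmod n (isT : 0 < 4)%N; have := ltn_pmod m (isT : 0 < 4)%N.
have En : (n %/ 2 = n %/ 4 * 2 + n %% 4 %/ 2)%N by lia.
have Em : (m %/ 2 = m %/ 4 * 2 + m %% 4 %/ 2)%N by lia.
rewrite {}En {}Em; move: nm2.
move: (n %/ 4)%N (m %/ 4)%N (n %% 4)%N (m %% 4)%N => p q i j.
case: i => [|[|[|[|//]]]]; case: j => [|[|[|[|//]]]] //= _ _ _ -> ->;
  by rewrite ?(divnn 2) ?div0n /=; split;
     rewrite -[LHS]mulr_natr -[RHS]mulr_natr !(natrD, natrM); field.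
Qed.

Lemma kappa_coef r : exists c, kappa r *+ r = (4 * c)%:R.
Proof.
rewrite /kappa; case: ifP => [/dvdnP[c ->]|_]; first by exists c; rewrite mulnC.
case: ifP => [/dvdnP[c ->]|_].
  by exists c; rewrite (_ : 4 * c = 2 * (c * 2))%N ?mulrnA //; lia.
by exists r; rewrite mulrnA.
Qed.

Section Torus.
Variables (F : fieldType) (K : closedFieldType) (iota : {rmorphism F -> K}).

Lemma PSp_invariant n a : S2_invariant (G := PSp iota n) (q_PSp n *~ Posz a).
Proof.
rewrite -pmulrn; apply: S2_invariantMn; have [c hc] := kappa_coef n.
apply: (quot_invariant (@diag_torus_Sp K n) _ hc) => //.
by rewrite /kappa; do ?[case: ifP => _]; rewrite ?rpred_nat ?rpred1.
Qed.

Lemma PSO_invariant n a : S2_invariant (G := PSO iota n) (q_PSO n *~ Posz a).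
Proof.
rewrite -pmulrn; apply: S2_invariantMn; have [c hc] := kappa_coef n.
apply: (quot_invariant (@diag_torus_SO K n) _ hc) => //.
by rewrite /kappa; do ?[case: ifP => _]; rewrite ?rpred_nat ?rpred1.
Qed.

Lemma prod_torus_nz (G H : splitGroup K) : torus_nz G -> torus_nz H ->
  torus_nz (prodSG iota G H).
Proof.
move=> hG hH t s [/hG h1 /hH h2] i; case: (split_ordP i) => j ->.
  by have := h1 j; rewrite mxE.
by have := h2 j; rewrite mxE.
Qed.

Lemma prod_torus_onto (G H : splitGroup K) : torus_onto G -> torus_onto H ->
  torus_onto (prodSG iota G H).
Proof.
move=> hG hH s hs; have [|t ht] := hG (lsubmx s); first by move=> i; rewrite mxE.
have [|u hu] := hH (rsubmx s); first by move=> i; rewrite mxE.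
by exists (t, u).
Qed.

Lemma prod_regM (G H : splitGroup K) (f g : prodSG iota G H -> K) :
  regular f -> regular g -> regular (fun x => f x * g x).
Proof. exact: subalg_mul. Qed.

Lemma induced_Sp_torus n m phi
    (phi' : prodSG iota (PSp iota n) (PSp iota m) -> HSpin iota (n * m)) :
    lifts_rho_Sp phi -> induced_Sp phi phi' ->
  torus_morph phi' (tensor_mx n (@sp_eta m)).
Proof.
move=> [_ hphi] [_ hphi'] [tA tB] s hs.
have s_nz : nz s.
  apply: (prod_torus_nz _ _ hs); exact: quot_torus_nz.
case: hs => -[A /= -> EA] [B /= -> EB].
exists (phi (A, B)); first exact: hphi'.
by have := hphi A B; rewrite /rho_Sp EA EB rho_Sp_diag_torus.
Qed.

Lemma induced_SO_torus n m phi
    (phi' : prodSG iota (PSO iota n) (PSO iota m) -> HSpin iota (n * m)) :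
    (0 < n)%N -> (0 < m)%N ->
    lifts_rho_SO phi -> induced_SO phi phi' ->
  torus_morph phi' (tensor_mx n (@evec m)).
Proof.
move=> n0 m0 [_ hphi] [_ hphi'] [tA tB] s hs.
have s_nz : nz s.
  apply: (prod_torus_nz _ _ hs); exact: quot_torus_nz.
case: hs => -[A /= -> EA] [B /= -> EB].
(* [phi] starts from spin groups, so the torus elements [A] and [B] must be lifted before it
   applies. *)
have [|g hg] := @spin_lift K n (lsubmx s) n0; first by move=> i; rewrite mxE.
have [|h hh] := @spin_lift K m (rsubmx s) m0; first by move=> i; rewrite mxE.
rewrite -EA in hg; rewrite -EB in hh.
exists (phi (g, h)); first exact: hphi'.
by have := hphi g h A B hg hh; rewrite /rho_SO EA EB kron_diag_torus.
Qed.

(** Pulled-back characters are regular because [phi] is an [alg_hom], so every half-spin weight can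
    be used in the presentation. *)
Lemma tensor_S2_map n m (G1 G2 : splitGroup K) (phi : prodSG iota G1 G2 -> HSpin iota (n * m))
    (M : 'M[int]_(2 * (n * m), rank G1 + rank G2)) :
    (0 < n * m)%N -> (2 %| n * m)%N -> torus_nz G1 -> torus_nz G2 ->
    alg_hom phi -> torus_morph phi M ->
  S2_map phi (q_HSpin (n * m)) (subst_mx (ratmx M) (q_HSpin (n * m))).
Proof.
move=> nm0 nm2 nz1 nz2 hphi hM; have nzG := prod_torus_nz nz1 nz2.
apply: S2_map_span; apply: (@hspin_span K) => // [u v|i ei].
  rewrite mulmxDl; apply: weight_mapD => //; last exact: hspin_torus_nz.
    exact: prod_regM.
  exact: hspin_regM.
exists (spin_char i); first exact: spin_weight.
have hw := spin_weight iota ei.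
refine (has_weight_comp nzG hM (torus_char_comp hphi hM _) hw); by case: hw.
Qed.

Lemma subst_q_HSpin n m eta : (2 %| n)%N || (2 %| m)%N ->
    \sum_j eta j = 0 ->
    \sum_j linear_form (ratmx (eta j)) ^+ 2 = sum_sqr m *+ 2 ->
  subst_mx (ratmx (@tensor_mx n m eta)) (q_HSpin (n * m)) =
  S2_pair (q_PSp n *~ Posz (rost_table n m).1) (q_PSp m *~ Posz (rost_table n m).2).
Proof.
move=> nm2 eta0 eta2; rewrite subst_mxZ subst_tensor_mx //.
have [E1 E2] := rost_table_coef nm2.
rewrite -!pmulrn /q_PSp !scalerMnl E1 E2 -!scalerMnl !scalerMnr.
by rewrite /S2_pair !comp_mpolyZ scalerDr.
Qed.

End Torus.

Theorem theorem12 (F : fieldType) (K : closedFieldType)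
    (iota : {rmorphism F -> K}) (char_F : 2%N \notin [pchar F])
    (n m : nat) (n_gt0 : (1 <= n)%N) (m_gt0 : (1 <= m)%N)
    (n_or_m_even : (2 %| n)%N || (2 %| m)%N)
    (phi_Sp : prodSG iota (Sp iota n) (Sp iota m) -> Spin iota (2 * (n * m))%N)
    (phi_Sp_lifts : lifts_rho_Sp phi_Sp)
    (phi_Sp' : prodSG iota (PSp iota n) (PSp iota m) -> HSpin iota (n * m)%N)
    (phi_Sp'_induced : induced_Sp phi_Sp phi_Sp')
    (phi_SO : prodSG iota (Spin iota n) (Spin iota m) ->
              Spin iota (2 * (n * m))%N)
    (phi_SO_lifts : lifts_rho_SO phi_SO)
    (phi_SO' : prodSG iota (PSO iota n) (PSO iota m) -> HSpin iota (n * m)%N)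
    (phi_SO'_induced : induced_SO phi_SO phi_SO') :
  (forall a b : int,
     rost_multipliers phi_Sp' (q_HSpin (n * m)%N) (q_PSp n) (q_PSp m) a b <->
     rost_multipliers phi_SO' (q_HSpin (n * m)%N) (q_PSO n) (q_PSO m) a b) /\
  (let (a, b) := rost_table n m in
   rost_multipliers phi_Sp' (q_HSpin (n * m)%N) (q_PSp n) (q_PSp m) a b /\
   rost_multipliers phi_SO' (q_HSpin (n * m)%N) (q_PSO n) (q_PSO m) a b).
Proof.
have nm0 : (0 < n * m)%N by rewrite muln_gt0 n_gt0.
have nm2 : (2 %| n * m)%N by rewrite Euclid_dvdM.
have inv := @hspin_invariant F K iota (n * m) nm0 nm2.
have MSp := induced_Sp_torus phi_Sp_lifts phi_Sp'_induced.
have MSO := induced_SO_torus n_gt0 m_gt0 phi_SO_lifts phi_SO'_induced.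
have nzSp r : torus_nz (PSp iota r) by exact: quot_torus_nz.
have nzSO r : torus_nz (PSO iota r) by exact: quot_torus_nz.
have ontoSp r : torus_onto (PSp iota r) by apply: quot_torus_onto; exact: diag_torus_Sp.
have ontoSO r : torus_onto (PSO iota r) by apply: quot_torus_onto; exact: diag_torus_SO.
have ESp := subst_q_HSpin n_or_m_even (sp_eta_sum0 m) (sp_eta_sum_sqr m).
have ESO := subst_q_HSpin n_or_m_even (evec_sum0 m) (evec_sum_sqr m).
have RSp : rost_multipliers phi_Sp' (q_HSpin (n * m)%N) (q_PSp n) (q_PSp m)
    (rost_table n m).1 (rost_table n m).2.
  split=> //.
    by apply: S2_invariant_pair; by [exact: quot_one_torus | exact: PSp_invariant].
  rewrite -ESp; apply: tensor_S2_map => //; exact: phi_Sp'_induced.1.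
have RSO : rost_multipliers phi_SO' (q_HSpin (n * m)%N) (q_PSO n) (q_PSO m)
    (rost_table n m).1 (rost_table n m).2.
  split=> //.
    by apply: S2_invariant_pair; by [exact: quot_one_torus | exact: PSO_invariant].
  rewrite -[S2_pair _ _]ESO; apply: tensor_S2_map => //; exact: phi_SO'_induced.1.
split; last by case: rost_table RSp RSO.
(* By uniqueness the form given by [a] and [b] is the one given by the table; [q_PSp] and [q_PSO]
   being the same polynomial, the claim for the other map is its table entry. *)
move=> a b; split=> -[_ _].
  move/(S2_map_subst (prod_torus_nz (nzSp n) (nzSp m))
          (prod_torus_onto (ontoSp n) (ontoSp m)) MSp).
  by rewrite ESp /rost_multipliers -[q_PSp n]/(q_PSO n) -[q_PSp m]/(q_PSO m) => ->.
move/(S2_map_subst (prod_torus_nz (nzSO n) (nzSO m))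
          (prod_torus_onto (ontoSO n) (ontoSO m)) MSO).
by rewrite ESO /rost_multipliers -[q_PSO n]/(q_PSp n) -[q_PSO m]/(q_PSp m) => ->.
Qed.
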